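(* Let $|A|=n\ge 2$ and $k\ge 1$. For any subset $S\subseteq[1,k]$, the $S_n$-module induced by the action of $S_n$ on the maximal chains of the rank-selected subposet $A^*_{n,k}(S)$ is a nonnegative integer combination of tensor powers of the irreducible $S_{(n-1,1)}$. Hence, for any $T\subseteq[1,k]$ with $T\neq\emptyset$, the $S_n$-representation on the homology of the rank-selected subposet $A^*_{n,k}(T)$ is (as a virtual module) an integer combination of positive tensor powers of $S_{(n-1,1)}$. The highest tensor power that can occur is the $m$th, where $m=\max(T)$; that is, the combination involves only $S_{(n-1,1)}^{\otimes i}$ with $1\le i\le m$.
   Context: $A^*$ is the set of all finite words in the alphabet $A$, $|A|=n$, including the empty word, ordered by the subword order: $u\le v$ if $u$ is obtained from $v$ by deleting letters (not necessarily consecutive). The rank of a word is its length. For $S\subseteq[1,k]=\{1,\dots,k\}$, $A^*_{n,k}(S)$ is the subposet of words with length in $S$; its maximal chains are the chains having exactly one word of each length in $S$ (for $S=\emptyset$, only the empty chain). Homology means reduced simplicial homology, with complex coefficients, of the order complex (any attached bottom or top element is removed first); it is concentrated in degree $|T|-1$. $S_n$ acts by permuting the letters of $A$. $S_{(n-1,1)}$ is the irreducible complex $S_n$-module indexed by $(n-1,1)$; its $0$th tensor power is the trivial module $S_{(n)}$. *)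

(* Defs.v *)
From HB Require Import structures.
From mathcomp Require Import all_boot all_order all_algebra all_fingroup.
From mathcomp Require Import mxrepresentation character.

Set Implicit Arguments.
Unset Strict Implicit.
Unset Printing Implicit Defensive.

Import GRing.Theory.
Local Open Scope ring_scope.

Section PermutationModule.
Variables (F : fieldType) (gT : finGroupType) (X : finType).
Variables (to : {action gT &-> X}) (D : {set X}).
Hypothesis actsD : [acts [set: gT], on D | to].

(* Row vectors, with the group acting on the right, as everywhere in mxrepresentation:
   the basis vector of x is sent by g to the basis vector of [to x g]. *)
Definition permmod_mx (g : gT) : 'M[F]_#|D| :=
  \matrix_(i, j) (to (enum_val i) g == enum_val j)%:R.

Lemma permmod_row g i (v : X -> F) :
  \sum_j permmod_mx g i j * v (enum_val j) = v (to (enum_val i) g).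
Proof.
have Dx : to (enum_val i) g \in D.
  by rewrite (acts_act actsD) ?inE // enum_valP.
rewrite (bigD1 (enum_rank_in Dx (to (enum_val i) g))) //= mxE.
rewrite enum_rankK_in // eqxx mul1r big1 ?addr0 // => j neq_j.
rewrite mxE; case: eqP => [def_j|]; last by rewrite mul0r.
by case/eqP: neq_j; apply: enum_val_inj; rewrite enum_rankK_in.
Qed.

Lemma permmod_mx_repr : mx_repr [set: gT] permmod_mx.
Proof.
split=> [|g h _ _]; apply/matrixP=> i j.
  by rewrite !mxE act1 (inj_eq enum_val_inj).
rewrite [RHS]mxE mxE actM.
rewrite -(permmod_row g i (fun x => (to x h == enum_val j)%:R)).
by apply: eq_bigr => l _; congr (_ * _); rewrite mxE.
Qed.

Definition permmod_repr := MxRepresentation permmod_mx_repr.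
End PermutationModule.

Section OrderComplex.
Variables (F : fieldType) (gT : finGroupType) (X : finType).
Variables (to : {action gT &-> X}) (le : rel X) (P : {set X}).

(* [le] is a partial order on [X]; simplices of the order complex of the subposet [P]
   are represented by their sets of vertices. *)
Definition is_chain (c : {set X}) : bool :=
  (c \subset P) && [forall x in c, forall y in c, le x y || le y x].

Definition max_chains : {set {set X}} := [set c | maxset is_chain c].

(* The simplices with j vertices, i.e. of dimension j - 1; for j = 0 this is the
   empty simplex alone, which makes the homology below the reduced one. *)
Definition simplices (j : nat) : {set {set X}} := [set c | is_chain c & #|c| == j].

(* Position of x in the increasing enumeration of the chain c. *)
Definition chain_index (c : {set X}) (x : X) : nat :=
  #|[set y in c | (y != x) && le y x]|.

(* The boundary map from the d-simplices to the (d-1)-simplices, acting on row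
   vectors from the right: [x_0 < ... < x_d] is sent to the sum over i of
   (-1)^i [x_0 < ... (omit x_i) ... < x_d]. *)
Definition face_coef (c c' : {set X}) : F :=
  \sum_(x in c | c :\ x == c') (-1) ^+ chain_index c x.

Definition boundary (d : nat) : 'M[F]_(#|simplices d.+1|, #|simplices d|) :=
  \matrix_(i, j) face_coef (enum_val i) (enum_val j).

Hypothesis le_act : forall g, {mono to^~ g : x y / le x y}.
Hypothesis actsP : [acts [set: gT], on P | to].

Lemma is_chain_act c g : is_chain (setact to c g) = is_chain c.
Proof.
suffices imp c' g' : is_chain c' -> is_chain (setact to c' g').
  by apply/idP/idP => [/(imp _ g^-1%g)|/imp //]; rewrite actK.
case/andP=> sc'P /forall_inP ch_c'; apply/andP; split.
  apply/subsetP=> _ /imsetP[x c'x ->].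
  by rewrite (acts_act actsP) ?inE // (subsetP sc'P).
apply/forall_inP=> _ /imsetP[x c'x ->]; apply/forall_inP=> _ /imsetP[y c'y ->].
by rewrite !le_act; have /forall_inP := ch_c' x c'x; apply.
Qed.

Lemma acts_max_chains : [acts [set: gT], on max_chains | to^*].
Proof.
apply/subsetP=> g _; rewrite !inE; apply/subsetP=> c.
rewrite !inE => /maxsetP[ch_c max_c]; apply/maxsetP; split=> [|b ch_b s_cb].
  by rewrite is_chain_act.
rewrite -[b](actKV to^* g) /=; congr setact.
apply: max_c; first by rewrite is_chain_act.
rewrite -[c](actK to^* g) /=; exact: imsetS.
Qed.

Lemma acts_simplices j : [acts [set: gT], on simplices j | to^*].
Proof.
apply/subsetP=> g _; rewrite !inE; apply/subsetP=> c.
by rewrite !inE is_chain_act /= card_setact.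
Qed.

Definition max_chain_repr := permmod_repr F acts_max_chains.

Definition simplex_repr j := permmod_repr F (acts_simplices j).

Lemma boundary_act d g :
  simplex_repr d.+1 g *m boundary d = boundary d *m simplex_repr d g.
Proof.
have to_inj : injective (to^~ g) by apply: act_inj.
apply/matrixP=> i j; rewrite !mxE; set c := enum_val i; set c' := enum_val j.
pose b := setact to c' g^-1%g.
have sb : b \in simplices d.
  have := enum_valP j; rewrite !inE => /andP[ch_c' card_c'].
  by rewrite is_chain_act ch_c' card_setact.
have to_b : to^*%act b g = c' by exact: (actKV to^* g c').
transitivity (face_coef c b); last first.
  rewrite (bigD1 (enum_rank_in sb b)) //= !mxE enum_rankK_in //.
  rewrite to_b eqxx mulr1 big1 ?addr0 // => l neq_l.
  rewrite !mxE; case: eqP => [def_l|]; last by rewrite mulr0.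
  case/eqP: neq_l; apply: enum_val_inj; rewrite enum_rankK_in //.
  by rewrite /b /c' -def_l; exact: esym (actK to^* g (enum_val l)).
transitivity (face_coef (setact to c g) c').
  rewrite -(permmod_row (acts_simplices d.+1) g i (fun x => face_coef x c')).
  by apply: eq_bigr => l _; rewrite !mxE.
rewrite /face_coef big_mkcondr [RHS]big_mkcondr /= big_imset /=; last first.
  by move=> x y _ _; apply: to_inj.
apply: eq_bigr => x _.
have -> : setact to c g :\ to x g = setact to (c :\ x) g.
  apply/setP=> u; rewrite !inE; apply/andP/imsetP => [[neq_u /imsetP[z cz def_u]]|[z]].
    by exists z; rewrite // !inE cz andbT -(inj_eq to_inj) -def_u.
  rewrite !inE => /andP[zx cz] ->; rewrite (inj_eq to_inj) zx.
  by split=> //; apply: imset_f.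
rewrite -to_b (inj_eq (act_inj to^* g)); case: ifP => // _; congr (_ ^+ _).
rewrite /chain_index -[RHS](card_imset _ to_inj); apply: eq_card => y.
rewrite !inE; apply/andP/imsetP => [[/imsetP[z cz ->]]|[z]].
  by rewrite le_act (inj_eq to_inj) => zx; exists z; rewrite // !inE cz.
rewrite !inE => /andP[cz zx] ->; rewrite le_act (inj_eq to_inj) zx.
by split=> //; apply: imset_f.
Qed.

Definition cycles d := kermx (boundary d).
Definition boundaries d : 'M[F]_#|simplices d.+1| := <<boundary d.+1>>%MS.

Lemma cycles_module d : mxmodule (simplex_repr d.+1) (cycles d).
Proof.
apply/mxmoduleP=> g _; apply/sub_kermxP.
by rewrite -mulmxA boundary_act mulmxA mulmx_ker mul0mx.
Qed.

Lemma boundaries_module d : mxmodule (simplex_repr d.+1) (boundaries d).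
Proof.
apply/mxmoduleP=> g _; rewrite (eqmxMr _ (genmxE _)) genmxE.
by rewrite -boundary_act submxMl.
Qed.

(* The reduced homology in degree d >= 0, i.e. the image of [cycles d] in the
   quotient of the chain space by [boundaries d]. *)
Definition homology_repr d :=
  section_repr (boundaries_module d) (cycles_module d).
End OrderComplex.

Section RankSelectedWords.
Variables (F : fieldType) (A : finType) (k : nat).

Definition subword : rel (k.-bseq A) := fun u v => subseq u v.

Definition permute_word (w : k.-bseq A) (s : {perm A}) : k.-bseq A :=
  [bseq of map s w].

Lemma permute_word1 w : permute_word w 1%g = w.
Proof.
by apply: val_inj => /=; rewrite -[RHS]map_id; apply: eq_map => a; rewrite perm1.
Qed.

Lemma permute_wordM w s t :
  permute_word w (s * t)%g = permute_word (permute_word w s) t.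
Proof.
by apply: val_inj => /=; rewrite -map_comp; apply: eq_map => a; rewrite /= permM.
Qed.

Definition word_action := TotalAction permute_word1 permute_wordM.

Lemma subword_act s : {mono word_action^~ s : u v / subword u v}.
Proof.
move=> u v; rewrite /subword /=; apply/idP/idP; last exact: map_subseq.
move/(map_subseq (s^-1)%g); rewrite -!map_comp.
by rewrite (eq_map (permK s)) (eq_map (permK s)) !map_id.
Qed.

(* A set of ranks is a subset of {0, ..., k}; subsets of [1, k] are those without 0. *)
Definition rank_selected (S : {set 'I_k.+1}) : {set k.-bseq A} :=
  [set w : k.-bseq A | [exists i in S, size w == i]].

Lemma acts_rank_selected S :
  [acts [set: {perm A}], on rank_selected S | word_action].
Proof.
apply/subsetP=> s _; rewrite !inE; apply/subsetP=> w.
by rewrite !inE /= size_map.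
Qed.

Definition word_max_chain_repr (S : {set 'I_k.+1}) :=
  max_chain_repr F subword_act (acts_rank_selected S).

Definition word_homology_repr (S : {set 'I_k.+1}) (d : nat) :=
  homology_repr F subword_act (acts_rank_selected S) d.
End RankSelectedWords.

Section TensorCombinations.
Variables (F : fieldType) (gT : finGroupType) (G : {group gT}).
Local Notation reprG := (representation F G).

Lemma trivial_mx_repr : mx_repr G (fun=> 1%:M : 'M[F]_1).
Proof. by split=> // g h _ _; rewrite mulmx1. Qed.

Definition trivial_repr := MxRepresentation trivial_mx_repr.

Definition tensor_power (V : reprG) (i : nat) : reprG :=
  iter i (fun W : reprG => Representation (prod_repr V W)) (Representation trivial_repr).

(* The direct sum of the c i copies of W i, for i in r. *)
Definition multiple_sum (W : nat -> reprG) (r : seq nat) (c : nat -> nat) : reprG :=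
  \big[dadd_grepr/grepr0]_(i <- r) muln_grepr (W i) (c i).

Definition nat_combination (V : reprG) (W : nat -> reprG) (r : seq nat) : Prop :=
  exists c : nat -> nat, mx_rsim V (multiple_sum W r c).

(* [V] = \sum_(i <- r) (a i - b i) [W i] in the Grothendieck group of G-modules. *)
Definition int_combination (V : reprG) (W : nat -> reprG) (r : seq nat) : Prop :=
  exists a b : nat -> nat,
    mx_rsim (dadd_grepr V (multiple_sum W r b)) (multiple_sum W r a).
End TensorCombinations.

Section StandardSpecht.
Variables (F : fieldType) (A : finType).

Lemma acts_letters : [acts [set: {perm A}], on [set: A] | 'P].
Proof. by apply/subsetP=> s _; rewrite !inE; apply/subsetP=> a; rewrite !inE. Qed.

Definition letters_repr := permmod_repr F acts_letters.

(* The Specht module of shape (n-1,1), n = #|A|, spanned by the polytabloids: a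
   tabloid of this shape is determined by the letter in its second row, so that the
   space of tabloids is [letters_repr], and the polytabloid of a tableau whose first
   column is (a, b) is b - a. *)
Definition polytabloid_mx : 'M[F]_#|[set: A]| :=
  (\sum_i \sum_j <<delta_mx 0 j - delta_mx 0 i : 'rV_#|[set: A]|>>)%MS.

Lemma polytabloid_module : mxmodule letters_repr polytabloid_mx.
Proof.
apply/mxmoduleP=> s _; rewrite /polytabloid_mx.
pose x (i : 'I_#|[set: A]|) := s (@enum_val A (mem [set: A]) i).
pose p (i : 'I_#|[set: A]|) := enum_rank_in (in_setT (x i)) (x i).
have delta_s i : delta_mx 0 i *m letters_repr s = delta_mx 0 (p i) :> 'rV_#|[set: A]|.
  rewrite -rowE; apply/rowP=> j; rewrite !mxE eqxx /=; congr (_ : bool)%:R.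
  apply/eqP/eqP=> [def_j | ->]; last by rewrite enum_rankK_in ?inE.
  by apply: enum_val_inj; rewrite enum_rankK_in ?inE.
rewrite (sumsmxMr_gen _ _); apply/sumsmx_subP=> i _; rewrite genmxE.
rewrite (sumsmxMr_gen _ _); apply/sumsmx_subP=> j _; rewrite genmxE.
rewrite (eqmxMr _ (genmxE _)) mulmxBl !delta_s.
by apply: (sumsmx_sup (p i)) => //; apply: (sumsmx_sup (p j)); rewrite ?genmxE.
Qed.

Definition specht_n1_1 : representation F [set: {perm A}] :=
  Representation (submod_repr polytabloid_module).
End StandardSpecht.

(* Main.v *)
Require Import Defs.
From mathcomp Require Import all_boot all_order all_algebra all_fingroup.
From mathcomp Require Import zify.
From mathcomp Require Import pgroup mxrepresentation character complex reals.

(** The trace of g on the maximal chains of rank set S counts the chains of words over the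
    f letters fixed by g. The number of words of length b over f letters that contain a
    given word of length a depends only on a and b, and is a polynomial in f - 1 with
    nonnegative coefficients; so is the number of chains, of degree max S and with constant
    term 1. As f - 1 is the trace of g on the Specht module, and traces determine modules
    in characteristic 0, this gives the first claim.

    For the homology, an acyclic matching in the sense of discrete Morse theory shows that
    the order complex of the ranks in T is exact below its top degree. So the trace of g on
    the top homology is the alternating sum over S in T of the previous polynomials, whose
    constant terms cancel when T is nonempty. In the matching, the word that belongs at
    rank t between u and v is obtained from v by deleting the leftmost letters outside the
    rightmost embedding of u; the first rank from the top which is missing or carries this
    word is toggled. *)

Set Implicit Arguments.
Unset Strict Implicit.
Unset Printing Implicit Defensive.

Import Order.TTheory GRing.Theory Num.Theory.
Local Open Scope ring_scope.

(** * Characters determine modules *)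

(** The obstacle is that being canonical depends on both neighbours in the chain, so inserting or
    deleting one word can change the status of the adjacent ones. Three rules for [cut] control
    this: cutting in two stages agrees with cutting once ([cut_cut]), a word already cut may replace
    the lower end ([cut_above]), and overlapping canonical gaps compose ([cut_trans]). Acyclicity
    needs a quantity that falls along every alternating path: missing ranks are filled with their
    canonical words, and the resulting costs are compared lexicographically from the top, the
    canonical word being the unique cheapest one in its gap ([cut_min]). Scanning from the top needs
    a word above the highest rank, which the word order does not single out; [universal_word]
    supplies it. The lower end of the last gap is the empty word, strictly shorter than every
    selected rank because rank 0 is excluded. *)

Lemma mxtrace_idempotent (F : fieldType) n (E : 'M[F]_n) :
  E *m E = E -> \tr E = (\rank E)%:R.
Proof.
move=> idE; rewrite -{1}[E]mulmx_base mxtrace_mulC -[RHS]mxtrace1; congr (\tr _).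
(* With the full-rank factorization [E = C R], the trace is that of [R C]; idempotence reads
   [C (R C) R = C R], and cancelling [C] and [R] leaves [R C = 1]. *)
apply: (row_free_inj (row_base_free E)); rewrite mul1mx.
apply: (row_full_inj (col_base_full E)).
by rewrite (mulmxA _ _ (row_base E)) (mulmxA _ _ (col_base E)) -(mulmxA _ (col_base E))
  !mulmx_base.
Qed.

Section CharacterDeterminesModule.
Variables (F : numClosedFieldType) (gT : finGroupType) (G : {group gT}).

Lemma gring_op_trace n1 n2 (rG1 : mx_representation F G n1)
    (rG2 : mx_representation F G n2) A :
  {in G, forall x, \tr (rG1 x) = \tr (rG2 x)} ->
  (A \in group_ring F G)%MS ->
  \tr (gring_op rG1 A) = \tr (gring_op rG2 A).
Proof.
move=> eq_tr /envelop_mxP[a ->]; rewrite !linear_sum; apply: eq_bigr => x Gx.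
by rewrite !linearZ /= !gring_opG // eq_tr.
Qed.

Lemma gring_op_submod n (rG : mx_representation F G n) (U : 'M_n)
    (modU : mxmodule rG U) A : (A \in group_ring F G)%MS ->
  gring_op (submod_repr modU) A = in_submod U (val_submod 1%:M *m gring_op rG A).
Proof.
move=> /envelop_mxP[a ->]; rewrite !(linear_sum, mulmx_sumr); apply: eq_bigr => x Gx.
by rewrite !linearZ /= !gring_opG // -scalemxAl.
Qed.

(** Induction on the dimension, splitting off one simple summand at a time. The central idempotent
    of a simple type acts as a projection, so its trace is its rank, which in characteristic 0
    vanishes only if the projection does. Equality of traces thus carries a simple type found in
    [rG1] over to [rG2]. *)
Lemma rsim_of_eq_mxtrace n1 n2 (rG1 : mx_representation F G n1)
    (rG2 : mx_representation F G n2) :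
  {in G, forall x, \tr (rG1 x) = \tr (rG2 x)} -> mx_rsim rG1 rG2.
Proof.
have F'G : ([pchar F]^'.-group G)%g.
  by apply/pgroupP=> p _ _; rewrite inE /= pchar_num.
have [m] := ubnP n1; elim: m n1 n2 rG1 rG2 => // m IHm n1 n2 rG1 rG2 /ltnSE le_n1 eq_tr.
have eq_n : n1 = n2.
  have := eq_tr 1%g (group1 G); rewrite !repr_mx1 !mxtrace1.
  by move/eqP; rewrite eqr_nat => /eqP.
have [n10 | n1_gt0] := posnP n1.
  exists 0 => // [|x _]; last by rewrite mulmx0 mul0mx.
  by rewrite /row_free mxrank0 n10.
pose iG : irrType F G := DecSocleType (regular_repr F G).
have eR (i : iG) : (Wedderburn_id i \in group_ring F G)%MS.
  by rewrite -(Wedderburn_sum_pchar iG F'G) (sumsmx_sup i) ?Wedderburn_id_mem.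
(* The idempotents sum to 1 and those of the other types kill [rG], so the one of its own type
   cannot. *)
have id_neq0 n (rG : mx_representation F G n) :
    mx_irreducible rG -> gring_op rG (Wedderburn_id (irr_comp iG rG)) != 0.
  move=> irrG; apply/eqP=> e0; have n_gt0: (0 < n)%N by case/mx_irrP: irrG.
  have: gring_op rG 1%:M = 0.
    rewrite -(Wedderburn_sum_id_pchar iG F'G) linear_sum (bigD1 (irr_comp iG rG)) //= e0 add0r.
    apply: big1 => i ne_i.
    exact: (irr_comp'_op0_pchar F'G irrG ne_i (Wedderburn_id_mem i)).
  by rewrite gring_op1 => /eqP; rewrite -mxrank_eq0 mxrank1 -leqn0 leqNgt n_gt0.
have nz1 : (1%:M : 'M[F]_n1) != 0 by rewrite -mxrank_eq0 mxrank1 -lt0n.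
have [U simU _] := dec_mxsimple_exists (mxmodule1 rG1) nz1.
have [modU nzU _] := simU.
pose i := irr_comp iG (submod_repr modU).
have irrU := (submod_mx_irr modU).2 simU.
have trE : \tr (gring_op rG1 (Wedderburn_id i)) != 0.
  rewrite mxtrace_idempotent; last first.
    rewrite -gring_opM; last exact: eR.
    have [_ _ idl _] := Wedderburn_is_id_pchar F'G i.
    by rewrite idl ?Wedderburn_id_mem.
  rewrite pnatr_eq0 mxrank_eq0.
  apply: contraNneq (id_neq0 _ _ irrU) => E0.
  by rewrite gring_op_submod // E0 mulmx0 linear0.
rewrite (gring_op_trace eq_tr (eR i)) in trE.
have := dec_mx_reducible_semisimple (mxmodule1 rG2) (mx_Maschke_pchar rG2 F'G).
case=> I W_ /= simW defW _.
(* An operator of nonzero trace cannot kill every simple summand of [rG2]; one that survives must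
   have type [i]. *)
have [j nz_Wj] : exists j, W_ j *m gring_op rG2 (Wedderburn_id i) != 0.
  apply/existsP; apply: contraNT trE => /existsPn W0.
  suffices ->: gring_op rG2 (Wedderburn_id i) = 0 by rewrite mxtrace0.
  apply/eqP; rewrite -submx0 -[X in (X <= _)%MS]mul1mx -(eqmxMr _ defW) sumsmxMr_gen.
  apply/sumsmx_subP=> j _; rewrite genmxE submx0; by move/negPn: (W0 j).
move: (W_ j) (simW j) nz_Wj => W simW' nzWE {W_ simW defW}.
have [modW nzW _] := simW'.
have irrW := (submod_mx_irr modW).2 simW'.
have eq_i : irr_comp iG (submod_repr modW) = i.
  apply/eqP; apply: contraNT nzWE; rewrite eq_sym => ne_i.
  have := irr_comp'_op0_pchar F'G irrW ne_i (Wedderburn_id_mem i).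
  rewrite gring_op_submod // => /(congr1 val_submod); rewrite linear0 in_submodK.
    move=> E0; rewrite -submx0 -(eqmxMr _ (val_submod1 W)) E0.
    by rewrite submx0.
  have /(mxmodule_envelop modW)->// :
    (gring_op rG2 (Wedderburn_id i) \in enveloping_algebra_mx rG2)%MS.
    by rewrite gring_opE gring_mxP.
  by rewrite val_submod1.
have simUW : mx_rsim (submod_repr modW) (submod_repr modU).
  apply: mx_rsim_trans (rsim_irr_comp_pchar iG F'G irrW) _.
  by rewrite eq_i; apply: mx_rsim_sym; apply: rsim_irr_comp_pchar.
(* The Maschke complements of the two isomorphic simple submodules again have equal traces, in
   smaller dimension. *)
have [U' modU' defU dxU] := mx_Maschke_pchar rG1 F'G modU (submx1 _).
have [W' modW' defW dxW] := mx_Maschke_pchar rG2 F'G modW (submx1 _).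
have simUW' : mx_rsim (submod_repr modW') (submod_repr modU').
  apply: mx_rsim_sym; apply: IHm => [|x Gx].
    apply: leq_trans le_n1; rewrite -[X in (_ < X)%N](mxrank1 F) -defU (mxdirectP dxU) /=.
    by rewrite -[X in (X < _)%N]add0n ltn_add2r lt0n mxrank_eq0.
  apply: (addrI (\tr (submod_repr modU x))).
  rewrite (mxtrace_dadd_mod _ _ (mxmodule1 rG1) defU dxU) //.
  rewrite -(mxtrace_rsim simUW) // (mxtrace_dadd_mod _ _ (mxmodule1 rG2) defW dxW) //.
  by rewrite !mxtrace_submod1 // eq_tr.
apply: mx_rsim_trans (mx_rsim_sym (rsim_submod1 (mxmodule1 rG1) (eqmx_refl _))) _.
apply: mx_rsim_sym.
apply: mx_rsim_trans (mx_rsim_sym (rsim_submod1 (mxmodule1 rG2) (eqmx_refl _))) _.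
pose rS := dadd_grepr (Representation (submod_repr modU)) (Representation (submod_repr modU')).
apply: (@mx_rsim_trans _ _ _ _ _ _ _ rS).
  exact: (mx_rsim_dadd (rU := Representation _) (rV := Representation _) (mxmodule1 rG2) defW
    dxW simUW simUW').
apply: mx_rsim_sym.
by apply: (mx_rsim_dadd (rU := Representation _) (rV := Representation _) (mxmodule1 rG1) defU
  dxU); apply: mx_rsim_refl.
Qed.
End CharacterDeterminesModule.

Section ModuleTraces.
Variables (F : fieldType) (gT : finGroupType) (G : {group gT}).

(** Rank-nullity made equivariant: [f] induces an isomorphism from the quotient by its kernel onto
    its image, and its matrix is written down explicitly. *)
Lemma mxtrace_ker_im m n (rU : mx_representation F G m)
    (rV : mx_representation F G n) (f : 'M_(m, n))
    (modK : mxmodule rU (kermx f)) (modI : mxmodule rV <<f>>%MS) :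
  {in G, forall x, rU x *m f = f *m rV x} ->
  {in G, forall x,
    \tr (rU x) = \tr (submod_repr modK x) + \tr (submod_repr modI x)}.
Proof.
move=> hom_f x Gx; rewrite -(mxtrace_sub_fact_mod modK); congr (_ + _).
have sI p (u : 'M_(p, m)) : (u *m f <= <<f>>)%MS by rewrite genmxE submxMl.
apply: mxtrace_rsim Gx; exists (in_submod <<f>>%MS (val_factmod 1%:M *m f)).
- by rewrite mxrank_coker mxrank_ker genmxE subKn ?rank_leq_row.
- rewrite -kermx_eq0; apply/eqP/row_matrixP=> i; rewrite row0.
  have: row i (kermx (in_submod <<f>>%MS (val_factmod 1%:M *m f)))
           *m in_submod <<f>>%MS (val_factmod 1%:M *m f) = 0.
    by rewrite -row_mul mulmx_ker row0.
  move: (row i _) => u; rewrite in_submodE mulmxA -in_submodE mulmxA -val_factmodE.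
  move/(congr1 val_submod); rewrite linear0 in_submodK // => /sub_kermxP.
  by rewrite -in_factmod_eq0 val_factmodK => /eqP.
move=> y Gy; rewrite -in_submodJ // -mulmxA -hom_f //.
rewrite in_submodE [LHS]mulmxA -in_submodE; congr in_submod.
rewrite (mulmxA (factmod_repr modK y)) -val_factmodE (mulmxA _ (rU y)) /= -(add_sub_fact_mod
  (kermx f) (val_factmod 1%:M *m rU y)).
by rewrite mulmxDl (sub_kermxP (val_submodP _)) add0r.
Qed.

(** Used in the top degree, where the boundaries vanish but the homology is still formed as a
    quotient. As [U] is only provably 0, the change of basis has to be given. *)
Lemma mx_rsim_section0 n (rG : mx_representation F G n) (U V : 'M_n)
    (modU : mxmodule rG U) (modV : mxmodule rG V) :
  U = 0 -> mx_rsim (submod_repr modV) (section_repr modU modV).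
Proof.
move=> U0; have sVI p (u : 'M_(p, n)) : (u <= V -> in_factmod U u <= <<in_factmod U V>>)%MS.
  by move=> suV; rewrite genmxE submxMr.
pose B := in_submod <<in_factmod U V>>%MS (in_factmod U (val_submod (1%:M : 'M_(\rank V)))).
have BE p (u : 'M_(p, _)) : u *m B = in_submod <<in_factmod U V>>%MS (in_factmod U (val_submod
  u)).
  rewrite /B in_submodE mulmxA -in_submodE (in_factmodE U (val_submod 1%:M)) mulmxA.
  by rewrite -in_factmodE -val_submodE.
exists B.
- apply: (@addIn (\rank U)); rewrite genmxE mxrank_in_factmod.
  by rewrite U0 mxrank0 addn0 adds0mx.
- rewrite -kermx_eq0; apply/eqP/row_matrixP=> i; rewrite row0.
  have: row i (kermx B) *m B = 0 by rewrite -row_mul mulmx_ker row0.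
  move: (row i _) => u; rewrite BE => /(congr1 val_submod); rewrite linear0.
  rewrite in_submodK ?sVI ?val_submodP // => /eqP; rewrite in_factmod_eq0 U0 submx0.
  by rewrite val_submod_eq0 => /eqP.
move=> x Gx; rewrite BE -[submod_repr modV x]mul1mx (val_submodJ modV) //.
rewrite in_factmodJ // (in_submodJ (section_module modU modV)) //.
by apply: sVI; apply: val_submodP.
Qed.

Lemma mxtrace_submod_eqmx n (rG : mx_representation F G n) (U V : 'M_n)
    (modU : mxmodule rG U) (modV : mxmodule rG V) :
  (U :=: V)%MS ->
  {in G, forall x, \tr (submod_repr modU x) = \tr (submod_repr modV x)}.
Proof. by move=> eqUV; apply/mxtrace_rsim/mx_rsim_iso/eqmx_iso. Qed.
End ModuleTraces.

Lemma mxtrace_permmod (F : fieldType) (gT : finGroupType) (X : finType)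
    (to : {action gT &-> X}) (D : {set X}) (actsD : [acts [set: gT], on D | to]) g :
  \tr (permmod_repr F actsD g) = #|[set x in D | to x g == x]|%:R.
Proof.
transitivity (\sum_(i < #|D|) (to (enum_val i) g == enum_val i)%:R : F).
  by apply: eq_bigr => i _; rewrite mxE.
rewrite -(big_enum_val (fun x => (to x g == x)%:R)) -sum1_card natr_sum /=.
rewrite big_mkcond [RHS]big_mkcond; apply: eq_bigr => x _; rewrite inE.
by case: (x \in D); case: eqP.
Qed.

(** * Order complexes and acyclic matchings *)

Section OrderComplexExactness.
Variables (F : numFieldType) (X : finType) (le : rel X) (P : {set X}).
Hypothesis le_anti : antisymmetric le.
Local Notation simplices := (simplices le P).
Local Notation boundary := (boundary F le P).

Lemma is_chainS (c c' : {set X}) : c' \subset c -> is_chain le P c -> is_chain le P c'.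
Proof.
move=> sc'c /andP[scP /forall_inP chc]; rewrite /is_chain (subset_trans sc'c) //=.
apply/forall_inP=> x c'x; apply/forall_inP=> y c'y.
by have /forall_inP := chc x (subsetP sc'c x c'x); apply; apply: (subsetP sc'c).
Qed.

Lemma simplicesD1 j c x : c \in simplices j.+1 -> x \in c -> c :\ x \in simplices j.
Proof.
rewrite !inE => /andP[chc /eqP cardc] cx; rewrite (is_chainS (subsetDl c [set x])) //=.
by have := cardsD1 x c; rewrite cx cardc => -[->].
Qed.

Lemma face_coef_sign (c : {set X}) x :
  x \in c -> face_coef F le c (c :\ x) = (-1) ^+ chain_index le c x.
Proof.
move=> cx; rewrite /face_coef (big_pred1 x) // => y /=.
apply/andP/eqP => [[cy /eqP eqD]| ->]; last by rewrite cx eqxx.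
apply/eqP; apply: contraTT cy => ne_yx; apply/negP => cy.
have : y \in c :\ y by rewrite eqD !inE ne_yx.
by rewrite !inE eqxx.
Qed.

Lemma face_coef_neq0 (c c' : {set X}) :
  face_coef F le c c' != 0 -> exists2 x, x \in c & c' = c :\ x.
Proof.
move=> nz; suff /existsP[x /andP[cx /eqP <-]] : [exists x, (x \in c) && (c :\ x == c')].
  by exists x.
by apply: contraNT nz => /existsPn noface; rewrite /face_coef big_pred0 // => x;
  apply/negbTE/noface.
Qed.

Lemma chain_indexD1 (c : {set X}) x y : y \in c -> x != y ->
  chain_index le c x = (le y x + chain_index le (c :\ y) x)%N.
Proof.
move=> cy ne_xy; rewrite /chain_index (cardsD1 y) !inE cy (eq_sym y) ne_xy /=;
  congr (_ + #|pred_of_set _|)%N.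
by apply/setP=> z; rewrite !inE andbA.
Qed.

Lemma boundary_boundary d : boundary d.+1 *m boundary d = 0.
Proof.
apply/matrixP=> i k; rewrite !mxE; set c := enum_val i; set c'' := enum_val k.
have simc : c \in simplices d.+2 := enum_valP i.
pose s x y : F := (-1) ^+ chain_index le c x * (-1) ^+ chain_index le (c :\ x) y.
pose Q x y := [&& x \in c, y \in c, x != y & (c :\ x :\ y == c'')].
transitivity (\sum_x \sum_(y | Q x y) s x y).
  transitivity (\sum_(c' in simplices d.+1) face_coef F le c c' * face_coef F le c' c'').
    by rewrite [RHS]big_enum_val; apply: eq_bigr => j _; rewrite !mxE.
  rewrite (eq_bigr (fun c' => \sum_(x | (x \in c) && (c :\ x == c'))
     (-1) ^+ chain_index le c x * face_coef F le (c :\ x) c'')); last first.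
    move=> c' _; rewrite {1}/face_coef mulr_suml; apply: eq_bigr => x /andP[_ /eqP <-] //.
  rewrite (exchange_big_dep (mem c)) /=; last by move=> ? ? _ /andP[].
  rewrite big_mkcond; apply: eq_bigr => x _; case: ifPn => [cx | ncx]; last first.
    by rewrite big_pred0 // => y; rewrite /Q (negbTE ncx).
  rewrite (big_pred1 (c :\ x)) => [|c' /=]; last first.
    rewrite cx /= eq_sym; case: eqP => [->|]; last by rewrite andbF.
    by rewrite (simplicesD1 simc cx).
  rewrite {1}/face_coef mulr_sumr; apply: eq_big => [y|y _] //.
  by rewrite /Q cx !inE (eq_sym x y) /=; case: (y != x); rewrite ?andbF //= .
(* The exponents for the two orders of deletion differ by one: only the larger of [x] and [y] has
   its index changed when the other is deleted. *)
have anti x y : Q x y -> s x y = - s y x.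
  case/and4P=> cx cy ne_xy _; rewrite /s -!exprD.
  rewrite (chain_indexD1 cy ne_xy) (chain_indexD1 cx (_ : y != x)) 1?eq_sym //.
  have: le x y (+) le y x.
    have := simc; rewrite !inE => /andP[/andP[_ /forall_inP chc] _].
    have /forall_inP/(_ y cy) cmp := chc x cx. have := @le_anti x y; move: cmp.
    case: (le x y) (le y x) => [] [] //= _ eqxy.
    by rewrite eqxy // eqxx in ne_xy.
  set a := chain_index _ _ _; set b := chain_index _ _ _; case: (le x y); case: (le y x) => //= _;
    by rewrite ?add0n ?add1n ?addSn exprS mulN1r ?opprK addnC.
(* Exchanging [x] and [y] negates the sum, and in characteristic 0 this forces it to vanish. *)
set S := (X in X = 0); have : S = - S.
  rewrite {2}/S (exchange_big_dep xpredT) //= -sumrN; apply: eq_bigr => x _.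
  rewrite -sumrN; apply: eq_big => y.
    by rewrite /Q (eq_sym x y) setDDl setUC -setDDl; case: (x \in c); rewrite ?andbF.
  by move/anti.
by move/eqP; rewrite -addr_eq0 -mulr2n mulrn_eq0 => /eqP.
Qed.

Section Matching.
Variables (disp : Order.disp_t) (K : orderType disp).
Variables (L : pred {set X}) (up : {set X} -> {set X}) (key : {set X} -> K).
Hypothesis up_chain : forall j c, c \in simplices j -> L c -> up c \in simplices j.+1.
Hypothesis up_sub : forall j c, c \in simplices j -> L c -> c \subset up c.
(* No cycle in the Hasse diagram once the matched edges are reversed. *)
Hypothesis up_key : forall j c c', c \in simplices j -> c' \in simplices j ->
  L c -> L c' -> c != c' -> c \subset up c' -> (key c < key c')%O.

Definition matched_simplices j : {set {set X}} := [set c in simplices j | L c].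

Definition matching_mx j : 'M[F]_#|matched_simplices j| :=
  \matrix_(i, k) face_coef F le (up (enum_val i)) (enum_val k).

Lemma matchedP j (i : 'I_#|matched_simplices j|) :
  enum_val i \in simplices j /\ L (enum_val i).
Proof. by have := enum_valP i; rewrite inE => /andP[]. Qed.

Lemma face_coef_up_neq0 j c : c \in simplices j -> L c -> face_coef F le (up c) c != 0.
Proof.
move=> sc Lc; have := up_chain sc Lc; rewrite inE => /andP[_ /eqP card_up].
have sub := up_sub sc Lc; move: (sc); rewrite inE => /andP[_ /eqP cardc].
have /cards1P[x def_x] : #|up c :\: c| == 1%N.
  by rewrite cardsD (setIidPr sub) card_up cardc subSnn.
have /setDP[ux ncx] : x \in up c :\: c by rewrite def_x inE.
have eqc : up c :\ x = c by rewrite -def_x setDDr setDv set0U (setIidPr sub).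
by rewrite -[X in face_coef _ _ _ X]eqc face_coef_sign // signr_eq0.
Qed.

(** At the largest key where [u] is nonzero, any off-diagonal contribution to that column would come
    from a simplex with a still larger key; only the nonzero diagonal entry is left. *)
Lemma matching_mx_free j m (u : 'M_(m, _)) : u *m matching_mx j = 0 -> u = 0.
Proof.
move=> uM0; apply/row_matrixP=> r; rewrite row0.
have {uM0}: row r u *m matching_mx j = 0 by rewrite -row_mul uM0 row0.
move: (row r u) => {m r}u uM0.
apply/eqP; apply: contraTT isT => /eqP/rowP nz_u; exfalso; apply: nz_u => i0; rewrite mxE.
apply/eqP; apply: contraTT isT => nz_i0; exfalso.
have [i nz_i max_i] := @Order.TotalTheory.arg_maxP _ _ _ i0 (fun i =>
  u 0 i != 0) (key \o enum_val) nz_i0.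
move: uM0 => /rowP/(_ i); rewrite !mxE (bigD1 i) //= big1 ?addr0 => [|k ne_ki]; last first.
  rewrite mxE; have [->|nz_k] := eqVneq (u 0 k) 0; first by rewrite mul0r.
  apply/eqP; rewrite mulf_eq0 (negbTE nz_k) /=; apply: contraTT (max_i k nz_k) => nz_f.
  have [x _ def_i] := face_coef_neq0 nz_f.
  have [si Li] := matchedP i; have [sk Lk] := matchedP k.
  rewrite -ltNge /=; apply: (up_key si sk) => //; first by rewrite (inj_eq enum_val_inj) eq_sym.
  by rewrite def_i subsetDl.
have [si Li] := matchedP i.
by move/eqP; rewrite mxE mulf_eq0 (negbTE nz_i) (negbTE (face_coef_up_neq0 si Li)).
Qed.

Definition up_mx j : 'M[F]_(#|matched_simplices j|, #|simplices j.+1|) :=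
  \matrix_(i, k) (up (enum_val i) == enum_val k)%:R.

Definition restrict_mx j : 'M[F]_(#|simplices j|, #|matched_simplices j|) :=
  \matrix_(k, i) (enum_val k == enum_val i)%:R.

Lemma mul_restrict_mx j m (u : 'M_(m, #|simplices j|)) r i k :
  enum_val k = enum_val i -> (u *m restrict_mx j) r i = u r k.
Proof.
move=> eq_ki; rewrite mxE (bigD1 k) //= mxE eq_ki eqxx mulr1 big1 ?addr0 // => k' ne_k.
by rewrite mxE -eq_ki (inj_eq enum_val_inj) (negbTE ne_k) mulr0.
Qed.

(** Exhibits the triangular matrix as the part of the boundary going from upper to lower partners,
    so that inverting it corrects a chain on [L] by a boundary. *)
Lemma up_boundary_restrict j : up_mx j *m boundary j *m restrict_mx j = matching_mx j.
Proof.
apply/matrixP=> r i; have [si Li] := matchedP i; have [sr Lr] := matchedP r.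
rewrite (mul_restrict_mx _ _ (enum_rankK_in si si)) mxE.
have sur := up_chain sr Lr; rewrite (bigD1 (enum_rank_in sur (up (enum_val r)))) //=.
rewrite !mxE !enum_rankK_in // eqxx mul1r big1 ?addr0 // => k ne_k.
rewrite mxE; case: eqP => [def_k|]; last by rewrite mul0r.
by case/eqP: ne_k; apply: enum_val_inj; rewrite enum_rankK_in.
Qed.

(** Two distinct simplices with the same partner would each have a smaller key than the other. *)
Lemma up_inj j c c' : c \in simplices j -> c' \in simplices j -> L c -> L c' ->
  up c = up c' -> c = c'.
Proof.
move=> sc sc' Lc Lc' eq_up; apply/eqP; apply: contraTT isT => ne_cc'.
have := up_key sc sc' Lc Lc' ne_cc'; rewrite -eq_up (up_sub sc Lc) => /(_ isT) lt1.
have := up_key sc' sc Lc' Lc; rewrite eq_sym eq_up (up_sub sc' Lc') => /(_ ne_cc' isT) lt2.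
by have := lt_trans lt1 lt2; rewrite ltxx.
Qed.

Lemma kill_matched j (u : 'rV_#|simplices j|) :
  exists w : 'rV_#|matched_simplices j|,
    (u - w *m up_mx j *m boundary j) *m restrict_mx j = 0.
Proof.
have unitM : matching_mx j \in unitmx.
  rewrite -row_free_unit -kermx_eq0; apply/eqP/matching_mx_free; exact: mulmx_ker.
exists (u *m restrict_mx j *m invmx (matching_mx j)).
rewrite mulmxBl -(mulmxA _ _ (boundary j)) -(mulmxA _ _ (restrict_mx j)).
by rewrite up_boundary_restrict mulmxKV ?subrr.
Qed.

Lemma restrict_eq0P j (u : 'rV_#|simplices j|) k :
  u *m restrict_mx j = 0 -> L (enum_val k) -> u 0 k = 0.
Proof.
move=> u0 Lk; have mk : enum_val k \in matched_simplices j by rewrite inE enum_valP.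
rewrite -(@mul_restrict_mx _ _ u 0 (enum_rank_in mk (enum_val k)) k) ?enum_rankK_in //.
by rewrite u0 mxE.
Qed.

(* Triangularity makes [matching_mx] invertible, so a cycle can be moved off [L] by a
   boundary; it is then supported on the image of [up], hence zero. *)
Lemma matching_exact0 : (forall c, c \in simplices 0 -> L c) ->
  (1%:M <= boundary 0)%MS.
Proof.
move=> allL; apply/row_subP=> i; have [w /restrict_eq0P u0] := kill_matched (row i 1%:M).
rewrite -[row i _](subrK (w *m up_mx 0 *m boundary 0)).
set v := _ - _ in u0 *; have -> : v = 0.
  by apply/rowP=> k; rewrite u0 ?mxE // allL ?enum_valP.
by rewrite add0r submxMl.
Qed.

Lemma matching_exact j :
    (forall c, c \in simplices j.+1 -> ~~ L c ->
       exists2 c', c' \in simplices j & L c' /\ up c' = c) ->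
  (kermx (boundary j) <= boundary j.+1)%MS.
Proof.
move=> cover; apply/row_subP=> i; have [w u0] := kill_matched (row i (kermx (boundary j))).
rewrite -[row i _](subrK (w *m up_mx j.+1 *m boundary j.+1)).
set v := _ - _ in u0 *; have vD0 : v *m boundary j = 0.
  by rewrite mulmxBl -row_mul mulmx_ker row0 -!mulmxA boundary_boundary !mulmx0 subrr.
move: v => v in u0 vD0 *.
(* [v] vanishes on [L], and by [cover] the other simplices are of the form [up c]; [y] records the
   coefficient of [v] there, each sum having a single term. *)
pose y : 'rV_#|matched_simplices j| :=
  \row_r \sum_(k | enum_val k == up (enum_val r)) v 0 k.
have def_v : v = y *m up_mx j.
  apply/rowP=> k; rewrite [RHS]mxE; have [Lk|nLk] := boolP (L (enum_val k)).
    rewrite (restrict_eq0P u0) // big1 // => r _; rewrite !mxE; case: eqP => [eq_k|];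
      last by rewrite mulr0.
    rewrite big1 ?mul0r // => k'; rewrite eq_k (inj_eq enum_val_inj) => /eqP->.
    exact: (restrict_eq0P u0).
  have [c sc [Lc up_c]] := cover _ (enum_valP k) nLk.
  have mc : c \in matched_simplices j by rewrite inE sc.
  rewrite (bigD1 (enum_rank_in mc c)) //= big1 ?addr0 => [|r ne_r]; last first.
    rewrite !mxE; case: eqP => [eq_r|]; last by rewrite mulr0.
    case/eqP: ne_r; apply: enum_val_inj; rewrite enum_rankK_in //.
    by have [sr Lr] := matchedP r; apply: (up_inj sr sc) => //; rewrite eq_r.
  rewrite !mxE enum_rankK_in // up_c eqxx mulr1 (big_pred1 k) // => k' /=.
  by rewrite (inj_eq enum_val_inj).
have : y *m matching_mx j = 0.
  by rewrite -up_boundary_restrict !mulmxA -def_v vD0 mul0mx.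
by move/matching_mx_free => y0; rewrite def_v y0 mul0mx add0r submxMl.
Qed.
End Matching.
End OrderComplexExactness.

Section TopHomologyTrace.
Variables (F : numFieldType) (gT : finGroupType) (X : finType).
Variables (to : {action gT &-> X}) (le : rel X) (P : {set X}).
Hypothesis le_anti : antisymmetric le.
Hypothesis le_act : forall g, {mono to^~ g : x y / le x y}.
Hypothesis actsP : [acts [set: gT], on P | to].

(** Rank-nullity, alternated: by exactness the image of each boundary is the space of cycles one
    degree lower, down to the augmentation, which is onto. The index [j] counts vertices, so cycles
    of degree [d] live on [j = d.+1]. *)
Lemma cycles_trace d g :
    (1%:M <= boundary F le P 0)%MS ->
    (forall j, (j < d)%N -> (kermx (boundary F le P j) <= boundary F le P j.+1)%MS) ->
  \tr (submod_repr (cycles_module F le_act actsP d) g) =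
    \sum_(j < d.+2) (-1) ^+ (d.+1 - j) * \tr (simplex_repr F le_act actsP j g).
Proof.
move=> exact0; elim: d => [|d IHd] exactd.
  have mod0 : mxmodule (simplex_repr F le_act actsP 0) <<boundary F le P 0>>%MS.
    rewrite (eqmx_module _ (genmxE _)) /mxmodule.
    by apply/subsetP=> x _; rewrite inE in_setT (submx_trans (submx1 _) exact0).
  have := mxtrace_ker_im (cycles_module F le_act actsP 0) mod0
    (fun g _ => boundary_act F le_act actsP 0 g) (in_setT g).
  rewrite [\tr (submod_repr mod0 g)]mxtrace_submod1 ?inE //; last first.
    by apply/eqmxP; rewrite submx1 genmxE.
  rewrite !big_ord_recl big_ord0 => ->.
  by rewrite !subn0 expr1 mulN1r /= /bump /= subnn expr0 mul1r addr0 addrC addrK.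
have := mxtrace_ker_im (cycles_module F le_act actsP d.+1) (boundaries_module F le_act actsP d)
  (fun g _ => boundary_act F le_act actsP d.+1 g) (in_setT g).
rewrite (mxtrace_submod_eqmx _ (cycles_module F le_act actsP d)) ?inE //; last first.
  apply/eqmxP; rewrite genmxE; apply/andP; split; last by rewrite genmxE; apply: exactd.
  by apply/sub_kermxP; apply: boundary_boundary.
rewrite IHd => [|j ltj]; last by rewrite exactd // ltnW.
move/eqP; rewrite -subr_eq => /eqP <-; rewrite [RHS]big_ord_recr /= subnn expr0 mul1r addrC.
congr (_ + _); rewrite -sumrN; apply: eq_bigr => j _.
by rewrite -mulNr -mulN1r -exprS -subSn // -ltnS ltn_ord.
Qed.

Lemma homology_top_trace d g :
    simplices le P d.+2 = set0 ->
    (1%:M <= boundary F le P 0)%MS ->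
    (forall j, (j < d)%N -> (kermx (boundary F le P j) <= boundary F le P j.+1)%MS) ->
  \tr (homology_repr F le_act actsP d g) =
    \sum_(j < d.+2) (-1) ^+ (d.+1 - j) * \tr (simplex_repr F le_act actsP j g).
Proof.
move=> top0 exact0 exactd; rewrite -cycles_trace //.
apply/esym/mxtrace_rsim; last exact: in_setT.
apply: mx_rsim_section0; apply/eqP; rewrite /boundaries -submx0 genmxE submx0.
apply/eqP/matrixP=> i; suff: enum_val i \in set0 by rewrite inE.
by rewrite -top0 enum_valP.
Qed.
End TopHomologyTrace.

(** * Canonical subwords *)

Section CanonicalSubword.
Variable A : eqType.
Implicit Types u v w : seq A.
Local Open Scope nat_scope.

(* Deletes from [v] the leftmost [k] letters outside the rightmost embedding of [u]. *)
Fixpoint shave v u k : seq A :=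
  if k is k'.+1 then
    if v is a :: v' then
      if subseq u v' then shave v' u k' else a :: shave v' (behead u) k
    else [::]
  else v.

Lemma shave0 v u : shave v u 0 = v. Proof. by case: v. Qed.

Lemma subseq_cons_behead a u v : subseq u (a :: v) -> ~~ subseq u v ->
  exists2 u', u = a :: u' & subseq u' v.
Proof.
case: u => [|b u] /=; first by rewrite sub0seq.
by case: eqP => [-> | _ -> //]; exists u.
Qed.

Lemma subseq_behead a u v : subseq (a :: u) v -> subseq u v.
Proof. exact: subseq_trans (subseq_cons u a). Qed.

Lemma shave_sub v u k : subseq (shave v u k) v.
Proof.
elim: v u k => [|a v IHv] u [|k] //=; first by rewrite eqxx subseq_refl.
case: ifP => _; last by rewrite eqxx IHv.
exact: subseq_trans (IHv _ _) (subseq_cons _ _).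
Qed.

Lemma size_shave v u k : subseq u v -> k + size u <= size v -> size (shave v u k) = size v - k.
Proof.
elim: v u k => [|a v IHv] u [|k] //= suv; rewrite ?subn0 //.
have [suv' le_k | nsuv] := ifPn; first by rewrite IHv // ?subSS.
have [u' -> su'v] := subseq_cons_behead suv nsuv.
by rewrite /= addnS ltnS => le_k; rewrite IHv // subSn // (leq_trans _ le_k) ?leq_addr.
Qed.

Lemma sub_shave v u k : subseq u v -> k + size u <= size v -> subseq u (shave v u k).
Proof.
elim: v u k => [|a v IHv] u [|k] //= suv.
have [suv' le_k | nsuv] := ifPn; first exact: IHv.
have [u' -> su'v] := subseq_cons_behead suv nsuv.
by rewrite /= addnS ltnS eqxx => le_k; apply: IHv.
Qed.

(** Deleting letters outside the rightmost embedding of [u] does not disturb that embedding, so the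
    second pass resumes where the first one stopped. *)
Lemma shave_shave v u k l : subseq u v -> k + l + size u <= size v ->
  shave (shave v u k) u l = shave v u (k + l).
Proof.
elim: v u k l => [|a v IHv] u [|k] l //= suv.
rewrite addSn; have [suv' le_k | nsuv] := ifPn; first exact: IHv.
have [u' eq_u su'v] := subseq_cons_behead suv nsuv; rewrite eq_u.
rewrite /= addnS ltnS => le_k; case: l le_k => [|l] le_k; first by rewrite addn0.
rewrite /=; case: ifPn => [sub | _]; last by rewrite IHv.
by case/negP: nsuv; rewrite eq_u; apply: subseq_trans sub _; rewrite shave_sub.
Qed.

(** The rightmost embedding of [shave v u (k + l)] in [v] omits exactly the [k + l] deleted letters,
    and the leftmost [k] of these are the ones that [u] selects. *)
Lemma shave_shaved v u k l : subseq u v -> k + l + size u <= size v ->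
  shave v (shave v u (k + l)) k = shave v u k.
Proof.
elim: v u k => [|a v IHv] u [|k] //= suv.
rewrite addSn /=; have [suv' | nsuv] := boolP (subseq u v) => [le_k|].
  by rewrite shave_sub IHv.
have [u' eq_u su'v] := subseq_cons_behead suv nsuv; rewrite {1 3}eq_u /=.
rewrite addnS ltnS => le_k; case: ifPn => [sub | _]; last by rewrite -addSn IHv eq_u.
case/negP: nsuv; apply: subseq_trans sub; rewrite eq_u /= eqxx.
by rewrite sub_shave.
Qed.

(* The letter [a] met before the rightmost embedding of [u] in [v] is either kept or
   deleted by [shave]; in the second case it precedes all the letters that are kept. *)
Lemma subseq_cons_shave a v u k : subseq (a :: u) v -> k + size u <= size v ->
  subseq (a :: u) (shave v u k) \/ subseq (a :: shave v u k) v.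
Proof.
elim: v k => [|b v IHv] [|k] //= sauv; first by left.
have suv : subseq u v by move: sauv; case: eqP => // _ /subseq_behead.
rewrite suv addSn ltnS; case: eqP sauv => [-> _ | _ sauv] le_k; first by right; rewrite shave_sub.
exact: IHv.
Qed.

(** The danger is a letter [a] of [v] that is kept for the sake of [w] although [u] alone would let
    it go. By [subseq_cons_shave], either [w] could then be embedded in [v] without it, or [u] could
    be embedded in [shave v w k] without it and [a] would be missing from [w]. The excess [l.+1]
    must be positive: with nothing deleted, the condition on [w] would not tie it to [u]. *)
Lemma shave_trans v w u k l : 
    subseq u v -> k + l.+1 + size u <= size v ->
    w = shave (shave v w k) u l.+1 -> subseq w v -> k + size w <= size v -> subseq u w ->
  shave v w k = shave v u k.
Proof.
elim: v w u k => [|a v IHv] w u [|k] //= suv le_kl.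
case: ifPn => [swv eq_w _ le_k suw | nswv].
  have suv' := subseq_trans suw swv; rewrite suv'; exact: (IHv w u k).
move=> + swv le_k suw; have [w' eq_w sw'v] := subseq_cons_behead swv nswv.
rewrite eq_w /= in le_k suw *; rewrite addnS ltnS in le_k.
case: ifPn => [sux eq_w'|nsux [eq_w']].
  case/negP: nswv; rewrite eq_w eq_w'; apply: subseq_trans (shave_sub _ _ _) _; exact: shave_sub.
have : subseq u (a :: shave v w' k.+1).
  by apply: (@subseq_trans _ (a :: w')); rewrite //= eqxx sub_shave.
case/subseq_cons_behead=> // u' eq_u su'x; rewrite eq_u in suv le_kl suw nsux eq_w' *.
have su'v : subseq u' v by apply: subseq_trans su'x (shave_sub _ _ _).
have su'w : subseq u' w' by move: suw; rewrite /= eqxx.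
have le_kl' : k.+1 + l.+1 + size u' <= size v by move: le_kl; rewrite /= addnS.
have eq_x : shave v w' k.+1 = shave v u' k.+1 by apply: IHv.
case: ifPn => [sauv | _]; last by rewrite eq_x.
have eq_w2 : w' = shave v u' (k.+1 + l.+1).
  by rewrite -shave_shave // -eq_x.
have [sauw | sawv] := subseq_cons_shave (k := k.+1 + l.+1) sauv le_kl'.
  case/negP: nsux; apply: subseq_trans sauw _; rewrite -eq_w2; exact: sub_shave.
by case/negP: nswv; rewrite eq_w eq_w2.
Qed.

(* Reads the letters of [v] kept by the rightmost embedding of [w] as a binary number, the
   leftmost letter being the most significant digit. *)
Fixpoint shave_cost v w : nat :=
  if v is a :: v' then
    if subseq w v' then shave_cost v' w else 2 ^ size v' + shave_cost v' (behead w)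
  else 0.

Lemma shave_cost_lt v w : shave_cost v w < 2 ^ size v.
Proof.
elim: v w => //= a v IHv w; rewrite expnS mul2n -addnn; case: ifP => _.
  by rewrite ltn_addr.
by rewrite ltn_add2l.
Qed.

(** At the first letter treated differently, [shave] deletes it and [w] keeps it; by [shave_cost_lt]
    that digit outweighs all later ones. *)
Lemma shave_cost_min v w u : subseq u w -> subseq w v ->
  w != shave v u (size v - size w) ->
  shave_cost v (shave v u (size v - size w)) < shave_cost v w.
Proof.
elim: v w u => [|a v IHv] w u suw; first by rewrite subseq0 => /eqP->.
move=> swv; have le_w := size_subseq swv.
have [eq_sz | ] := posnP (size (a :: v) - size w).
  rewrite eq_sz shave0; have /size_subseq_leqif [_] := swv => <-.
  by rewrite eqn_leq le_w -subn_eq0 eq_sz.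
case def_k: (size _ - size w) => [//|k] _ /=.
have [suv | nsuv] := ifPn.
  have def_k' : size v - size w = k by move: def_k => /=; lia.
  rewrite shave_sub; have [swv' | nswv] := ifPn; first by rewrite -def_k'; apply: IHv.
  by move=> _; rewrite (leq_trans (shave_cost_lt _ _)) ?leq_addr.
have nswv : ~~ subseq w v by apply: contra nsuv; apply: subseq_trans.
have [w' eq_w sw'v] := subseq_cons_behead swv nswv.
have [u' eq_u su'v] := subseq_cons_behead (subseq_trans suw swv) nsuv.
have su'w : subseq u' w' by move: suw; rewrite eq_u eq_w /= eqxx.
rewrite (negbTE nswv) eq_u eq_w /= eqseq_cons eqxx /= => ne_w.
have def_k' : size v - size w' = k.+1 by move: def_k; rewrite eq_w /=; lia.
rewrite ifN ?ltn_add2l -?def_k'; first by apply: IHv; rewrite // def_k'.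
apply: contra nsuv; apply: subseq_trans; rewrite eq_u /= eqxx.
apply: sub_shave => //.
by have := size_subseq su'w; have := size_subseq sw'v; lia.
Qed.
End CanonicalSubword.

(** * Toggling one rank of a chain of words, and the decrease of the key *)

Section RankFunctions.
Variable A : eqType.
Implicit Types (u v w x y : seq A) (f g : nat -> option (seq A)) (ts : seq nat).
Local Open Scope nat_scope.

Definition cut v u t := shave v u (size v - t).

Lemma cut_sub v u t : subseq (cut v u t) v.
Proof. exact: shave_sub. Qed.

Lemma size_cut v u t : subseq u v -> size u <= t -> t <= size v -> size (cut v u t) = t.
Proof. by move=> suv le_ut le_tv; rewrite size_shave //; lia. Qed.

Lemma sub_cut v u t : subseq u v -> size u <= t -> t <= size v -> subseq u (cut v u t).
Proof. by move=> suv le_ut le_tv; apply: sub_shave => //; lia. Qed.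

Lemma cut_cut v u s t : subseq u v -> size u <= t -> t <= s -> s <= size v ->
  cut (cut v u s) u t = cut v u t.
Proof.
move=> suv le_ut le_ts le_sv.
rewrite {1}/cut size_cut //; last exact: leq_trans le_ts.
by rewrite shave_shave //; [congr shave|]; lia.
Qed.

Lemma cut_above v u s t : subseq u v -> size u <= t -> t <= s -> s <= size v ->
  cut v (cut v u t) s = cut v u s.
Proof.
move=> suv le_ut le_ts le_sv; have -> : cut v u t = shave v u (size v - s + (s - t)).
  by congr shave; lia.
by rewrite /cut shave_shaved //; lia.
Qed.

Lemma cut_trans v u w s : subseq u w -> subseq w v -> size w < s -> s <= size v ->
  w = cut (cut v w s) u (size w) -> cut v w s = cut v u s.
Proof.
move=> suw swv lt_ws le_sv eq_w; have le_uw := size_subseq suw.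
apply: (@shave_trans _ _ _ _ _ (s - size w).-1) => //.
- exact: subseq_trans swv.
- by lia.
- by rewrite {1}eq_w {1}/cut size_cut ?(ltnW lt_ws) //; congr shave; lia.
by lia.
Qed.

Lemma cut_min v u w : subseq u w -> subseq w v -> w != cut v u (size w) ->
  shave_cost v (cut v u (size w)) < shave_cost v w.
Proof. exact: shave_cost_min. Qed.

Fixpoint next f ts : seq A :=
  if ts is t :: ts' then if f t is Some w then w else next f ts' else [::].

(** A rank with a non-canonical word is passed, and this word becomes the upper end of the next gap.
    The value [None] thus marks the critical chains: every rank is filled, never canonically. *)
Fixpoint toggle f v ts : option (seq A) :=
  if ts is t :: ts' then
    let y := cut v (next f ts') t in
    if f t is Some w then if w == y then Some y else toggle f w ts' else Some y
  else None.

(** Filling the missing ranks makes chains with different rank sets comparable; [seqlexi] gives the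
    top rank the most weight. *)
Fixpoint chain_key f v ts : seqlexi nat :=
  if ts is t :: ts' then
    let y := if f t is Some w then w else cut v (next f ts') t in
    shave_cost v y :: chain_key f y ts'
  else [::].

Fixpoint coherent f v ts : bool :=
  if ts is t :: ts' then
    (t <= size v) &&
    if f t is Some w then [&& size w == t, subseq w v & coherent f w ts']
    else coherent f v ts'
  else true.

(** The final 0 forces positive as well as decreasing ranks, so that the default [[::]] of [next] is
    shorter than every rank. *)
Definition ranks ts := sorted gtn (rcons ts 0).

Lemma ranks_cons t ts : ranks (t :: ts) -> ranks ts /\ {in ts, forall s, s < t}.
Proof.
rewrite /ranks /= => pth; split; first exact: path_sorted pth.
have trans : transitive gtn by move=> a b c /= ba ca; apply: ltn_trans ca ba.
move: pth; rewrite (path_sortedE trans) all_rcons => /andP[/andP[_ /allP lt_t] _] s.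
exact: lt_t.
Qed.

Lemma ranks_notin t ts : ranks (t :: ts) -> t \notin ts.
Proof. by move=> /ranks_cons[_ lt_t]; apply/negP => /lt_t; rewrite ltnn. Qed.

Lemma ranks_gt0 t ts : ranks (t :: ts) -> 0 < t.
Proof.
have trans : transitive gtn by move=> a b c /= ba ca; apply: ltn_trans ca ba.
by rewrite /ranks /= (path_sortedE trans) all_rcons => /andP[/andP[]].
Qed.

Lemma eq_next f g ts : {in ts, f =1 g} -> next f ts = next g ts.
Proof.
elim: ts => //= t ts IH eq_fg; rewrite eq_fg ?mem_head //; case: (g t) => //.
by apply: IH => s s_ts; rewrite eq_fg // inE s_ts orbT.
Qed.

Lemma next_sub f v ts : coherent f v ts -> subseq (next f ts) v.
Proof.
elim: ts v => /= [|t ts IH] v; first by rewrite sub0seq.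
by move=> /andP[_]; case: (f t) => [w /and3P[]|/IH].
Qed.

Lemma next_size f v t ts : ranks (t :: ts) -> coherent f v ts -> size (next f ts) < t.
Proof.
elim: ts t v => /= [|s ts IH] t v rk; first by move=> _; apply: ranks_gt0 rk.
have [rk' lt_t] := ranks_cons rk => /andP[_].
case: (f s) => [w /and3P[/eqP-> _ _]|co]; first by rewrite lt_t ?mem_head.
by apply: ltn_trans (lt_t s (mem_head _ _)); apply: IH co.
Qed.

Lemma coherent_rank f v t ts w : coherent f v ts -> t \in ts -> f t = Some w ->
  size w = t /\ subseq w v.
Proof.
elim: ts v => //= s ts IH v /andP[_ co]; rewrite inE => /predU1P[->|t_ts] ft.
  by move: co; rewrite ft => /and3P[/eqP].
case: (f s) co => [x /and3P[_ sub_x /IH[]//]|/IH[]//].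
by move=> sz sub_w; split=> //; apply: subseq_trans sub_x.
Qed.

Lemma coherent_top f v x ts : coherent f v ts -> subseq (next f ts) x ->
  {in ts, forall t, t <= size x} -> coherent f x ts.
Proof.
elim: ts => //= t ts IH /andP[_ co] sub le_x; rewrite le_x ?mem_head //=.
case: (f t) co sub => [w /and3P[-> _ ->] -> //|co sub].
by apply: IH => // s s_ts; apply: le_x; rewrite inE s_ts orbT.
Qed.

Lemma coherent_cut f v t ts : ranks (t :: ts) -> t <= size v -> coherent f v ts ->
  [/\ size (cut v (next f ts) t) = t, subseq (cut v (next f ts) t) v &
      coherent f (cut v (next f ts) t) ts].
Proof.
move=> rk le_tv co; have lt_nt := next_size rk co; have sub := next_sub co.
have sz := size_cut sub (ltnW lt_nt) le_tv; split=> //; first exact: cut_sub.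
apply: coherent_top co _ _; first by rewrite sub_cut // ltnW.
by move=> s /(ranks_cons rk).2 lt_st; rewrite sz ltnW.
Qed.

Lemma sub_cut_next f v t ts : ranks (t :: ts) -> t <= size v -> coherent f v ts ->
  subseq (next f ts) (cut v (next f ts) t).
Proof.
move=> rk le_tv co; apply: sub_cut => //; first exact: next_sub co.
exact/ltnW/(next_size rk co).
Qed.

Lemma toggleP f v ts y : ranks ts -> coherent f v ts -> toggle f v ts = Some y ->
  [/\ size y \in ts, subseq y v & f (size y) = None \/ f (size y) = Some y].
Proof.
elim: ts v => //= t ts IH v rk /andP[le_tv].
have [rk' lt_t] := ranks_cons rk.
case def_w: (f t) => [w|] co; last first.
  have [sz sub _] := coherent_cut rk le_tv co.
  by case=> <-; rewrite sz mem_head sub def_w; split; last by left.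
have /and3P[/eqP sz_w sub_w cow] := co; case: eqP => [eq_w [<-]|_ /IH[] // y_ts sub_y f_y].
  by rewrite -eq_w sz_w mem_head def_w; split; last by right.
by split; rewrite ?inE ?y_ts ?orbT //; apply: subseq_trans sub_w.
Qed.

Lemma coherent_next f v ts t w : coherent f v ts -> t \in ts -> f t = Some w ->
  subseq w (next f ts).
Proof.
elim: ts v => //= s ts IH v /andP[_ co]; rewrite inE => /predU1P[->|t_ts] ft.
  by rewrite ft.
by case: (f s) co => [x /and3P[_ _ /coherent_rank/(_ t_ts ft)[]]|/IH->].
Qed.

Lemma toggle_comparable f v ts y t w : ranks ts -> coherent f v ts ->
  toggle f v ts = Some y -> t \in ts -> f t = Some w -> subseq w y || subseq y w.
Proof.
elim: ts v => //= s ts IH v rk /andP[le_sv].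
have [rk' lt_s] := ranks_cons rk; case def_x: (f s) => [x|] co; last first.
  case=> <-; rewrite inE => /predU1P[->|t_ts ft]; first by rewrite def_x.
  by rewrite (subseq_trans (coherent_next co t_ts ft) (sub_cut_next rk le_sv co)).
have /and3P[_ _ cox] := co; case: eqP => [eq_x [eq_y]|_ tog]; rewrite inE => /predU1P[->|t_ts] ft.
- by rewrite -eq_y -eq_x; move: ft; rewrite def_x => -[->]; rewrite subseq_refl.
- by rewrite -eq_y -eq_x; have [_ ->] := coherent_rank cox t_ts ft.
- by have [_ + _] := toggleP rk' cox tog; move: ft; rewrite def_x => -[->] ->; rewrite orbT.
exact: IH tog t_ts ft.
Qed.

(** The canonical word of the gap around [t] serves: lying between its neighbours, it is comparable
    to the whole chain. This is how inclusion-maximal chains are seen to use every selected rank. *)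
Lemma coherent_extend f v ts t : ranks ts -> coherent f v ts -> t \in ts -> f t = None ->
  exists y, [/\ size y = t, subseq y v &
    {in ts, forall s w, f s = Some w -> subseq w y || subseq y w}].
Proof.
elim: ts v => //= r ts IH v rk /andP[le_rv]; rewrite inE.
have [rk' lt_r] := ranks_cons rk; have [-> co _ fr|ne_tr] := eqVneq t r.
  rewrite fr in co; have [sz sub _] := coherent_cut rk le_rv co.
  exists (cut v (next f ts) r); split=> // s; rewrite inE => /predU1P[->|s_ts] w;
    first by rewrite fr.
  by move/(coherent_next co s_ts) => sub_w;
    rewrite (subseq_trans sub_w (sub_cut_next rk le_rv co)).
case def_x: (f r) => [x|] co /= t_ts ft; last first.
  have [y [sz sub cmp]] := IH v rk' co t_ts ft; exists y; split=> // s.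
  by rewrite inE => /predU1P[->|/cmp//] w; rewrite def_x.
have /and3P[_ sub_x cox] := co; have [y [sz sub cmp]] := IH x rk' cox t_ts ft.
exists y; split=> //; first exact: subseq_trans sub_x.
by move=> s; rewrite inE => /predU1P[->|/cmp//] w; rewrite def_x => -[<-]; rewrite sub orbT.
Qed.

Lemma toggle_none f v ts : toggle f v ts = None -> {in ts, forall t, f t != None}.
Proof.
elim: ts v => //= t ts IH v; case def_w: (f t) => [w|//]; case: eqP => // _ /IH none s.
by rewrite inE => /predU1P[->|/none]; rewrite ?def_w.
Qed.

Section Update.
Variables (f g : nat -> option (seq A)) (s : nat).

Definition without ts := {in ts, forall t, g t = if t == s then None else f t}.

Lemma without_cons t ts : ranks (t :: ts) -> without (t :: ts) ->
  without ts /\ (t = s -> {in ts, g =1 f}).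
Proof.
move=> rk wo; split=> [r r_ts|eq_t r r_ts]; first by rewrite wo // inE r_ts orbT.
rewrite wo ?inE ?r_ts ?orbT // -eq_t.
by have := (ranks_cons rk).2 r r_ts; rewrite ltn_neqAle => /andP[/negbTE->].
Qed.

Lemma next_without ts x : ranks ts -> without ts -> f s = Some x ->
  next g ts = next f ts \/ next f ts = x.
Proof.
elim: ts => [|t ts IH] rk wo fs; first by left.
rewrite /= wo ?mem_head //; case: eqP => [->|_]; first by right; rewrite fs.
case: (f t) => [w|]; first by left.
by apply: IH => //; [have [] := ranks_cons rk | have [] := without_cons rk wo].
Qed.

Lemma next_without_sub v ts : ranks ts -> coherent f v ts -> without ts ->
  subseq (next g ts) (next f ts).
Proof.
elim: ts v => //= t ts IH v rk /andP[_ co] wo.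
have [rk' _] := ranks_cons rk; have [wo' eq_fg] := without_cons rk wo.
rewrite wo ?mem_head //; case: eqP => [/eq_fg eqn|_]; last first.
  by case: (f t) co => [w _|]; [exact: subseq_refl | move=> co; exact: (IH v)].
rewrite (eq_next eqn); case: (f t) co => [w /and3P[_ _ /next_sub]//|_].
exact: subseq_refl.
Qed.

(** Without [x] the lower end of the gap drops, and the old filling words still contain the new
    lower end. By [cut_min] the new ones therefore cost less as soon as they differ, which happens
    at rank [s] at the latest. *)
Lemma key_without v ts x : ranks ts -> coherent f v ts -> without ts ->
    s \in ts -> f s = Some x -> next f ts = x -> x != cut v (next g ts) s ->
  (chain_key g v ts < chain_key f v ts)%O.
Proof.
elim: ts v => //= t ts IH v rk /andP[le_tv co] wo s_ts fs.
have [rk' lt_t] := ranks_cons rk; have [wo' eq_fg] := without_cons rk wo.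
have := wo t (mem_head _ _); rewrite ltxi_cons.
have [eq_t|ne_t] := eqVneq t s.
  rewrite eq_t fs in co *; case/and3P: co => /eqP sz_x sub_x co -> _.
  rewrite (eq_next (eq_fg eq_t)) -{1 2}sz_x => ne_x.
  have := cut_min (next_sub co) sub_x ne_x; rewrite sz_x !leEnat => lt_cost.
  by rewrite (ltnW lt_cost) leqNgt lt_cost.
have {}s_ts : s \in ts by move: s_ts; rewrite inE eq_sym (negbTE ne_t).
case: (f t) co => [w|] co gt; rewrite gt => eq_x ne_x.
  case/and3P: co => /eqP sz_w _ /coherent_rank/(_ s_ts fs)[sz_x _].
  by case/eqP: ne_t; rewrite -sz_w -sz_x eq_x.
have [sz_cut sub_cut co_cut] := coherent_cut rk le_tv co.
have sub_gf := next_without_sub rk' co wo'; have lt_ft := next_size rk co.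
have sub_ft := sub_cut_next rk le_tv co.
have [eq_cut|ne_cut] := eqVneq (cut v (next f ts) t) (cut v (next g ts) t).
  rewrite -eq_cut lexx /=; apply: IH => //; apply: contra ne_x => /eqP ->.
  apply/eqP; rewrite eq_cut; apply: cut_cut => //.
  - by apply: subseq_trans sub_gf (next_sub co).
  - have [<- _] := coherent_rank co s_ts fs; rewrite -eq_x; exact: size_subseq.
  - exact/ltnW/lt_t.
rewrite -{2}sz_cut in ne_cut; have := cut_min (subseq_trans sub_gf sub_ft) sub_cut ne_cut.
by rewrite sz_cut !leEnat => lt_cost; rewrite (ltnW lt_cost) leqNgt lt_cost.
Qed.

End Update.

Lemma next_toggle_without f g v ts y : ranks ts -> coherent f v ts ->
    toggle f v ts = Some y -> f (size y) = Some y -> without f g (size y) ts ->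
  next g ts = next f ts \/
    next f ts = y /\ y = cut v (next g ts) (size y).
Proof.
case: ts => //= t ts rk /andP[le_tv co] tog fy wo.
have [rk' lt_t] := ranks_cons rk; have [wo' eq_fg] := without_cons rk wo.
rewrite wo ?mem_head //; have [eq_t|ne_t] := eqVneq t (size y).
  right; rewrite (eq_next (eq_fg eq_t)) eq_t fy; split=> //.
  move: tog co; rewrite eq_t fy; case: eqP => [//|_ tog /and3P[_ _ co]].
  have [] := toggleP rk' co tog; rewrite -eq_t => y_ts _ _.
  by have := ranks_notin rk; rewrite y_ts.
case def_w: (f t) tog co => [w|] tog co; first by left.
have [sz _ _] := coherent_cut rk le_tv co; case: tog => eq_y.
by case/eqP: ne_t; rewrite -eq_y sz.
Qed.

(** This makes insertion and deletion of the toggled word inverse to each other. A word passed above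
    [y] as non-canonical must not become canonical once [y] is gone. *)
Lemma toggle_without f g v ts y : ranks ts -> coherent f v ts ->
    toggle f v ts = Some y -> f (size y) = Some y -> without f g (size y) ts ->
  toggle g v ts = Some y.
Proof.
elim: ts v => //= t ts IH v rk /andP[le_tv co] tog fy wo.
have [rk' lt_t] := ranks_cons rk; have [wo' eq_fg] := without_cons rk wo.
rewrite wo ?mem_head //; have [eq_t|ne_t] := eqVneq t (size y).
  rewrite (eq_next (eq_fg eq_t)) eq_t.
  move: tog co; rewrite eq_t fy; case: eqP => [->//|_ tog /and3P[_ _ co]].
  have [] := toggleP rk' co tog; rewrite -eq_t => y_ts _ _.
  by have := ranks_notin rk; rewrite y_ts.
case def_w: (f t) tog co => [w|] tog co; last first.
  have [sz _ _] := coherent_cut rk le_tv co; case: tog => eq_y.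
  by case/eqP: ne_t; rewrite -eq_y sz.
have /and3P[/eqP sz_w sub_w cow] := co.
move: tog; case: eqP => [eq_w [eq_y]|ne_w tog].
  by case/eqP: ne_t; rewrite -eq_y -eq_w sz_w.
rewrite ifN; first exact: IH.
apply/eqP=> eq_w; have [y_ts sub_y _] := toggleP rk' cow tog.
have [eq_n|[eq_n eq_y]] := next_toggle_without rk' cow tog fy wo'.
  by rewrite eq_n in eq_w.
have sub_u : subseq (next g ts) y by rewrite -eq_n; apply: next_without_sub cow wo'.
have le_uy := size_subseq sub_u; have lt_yt := lt_t _ y_ts.
have sub_uv := subseq_trans sub_u (subseq_trans sub_y sub_w).
(* If [w] were canonical above [u = next g ts], then by [cut_cut] [y] would be [cut v u (size y)],
   and [cut_above] would make [w] canonical above [y] already. *)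
case: ne_w; rewrite eq_n {1}eq_w eq_y eq_w cut_cut ?(ltnW lt_yt) //.
by rewrite cut_above // ltnW.
Qed.

Lemma next_toggle_with f g v ts y : ranks ts -> coherent f v ts ->
    toggle f v ts = Some y -> f (size y) = None ->
    {in ts, forall t, g t = if t == size y then Some y else f t} ->
  next g ts = next f ts \/
    [/\ next g ts = y, subseq (next f ts) y & y = cut v (next f ts) (size y)].
Proof.
case: ts => //= t ts rk /andP[le_tv co] tog fy def_g; rewrite def_g ?mem_head //.
case def_w: (f t) tog co => [w|] tog co.
  by left; case: eqP def_w => // ->; rewrite fy.
have [sz _ _] := coherent_cut rk le_tv co; case: tog => eq_y.
by right; rewrite -eq_y sz eqxx (sub_cut_next rk).
Qed.

(* The acyclicity of the matching. *)
Lemma key_toggle f g v ts y s x z : ranks ts -> coherent f v ts ->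
    toggle f v ts = Some y -> f (size y) = None ->
    s \in ts -> f s = Some x ->
    {in ts, forall t, g t = if t == s then None else if t == size y then Some y else f t} ->
    toggle g v ts = Some z -> g (size z) = None ->
  (chain_key g v ts < chain_key f v ts)%O.
Proof.
elim: ts v => //= t ts IH v rk /andP[le_tv co] tog fy s_ts fs def_g togg gz.
have [rk' lt_t] := ranks_cons rk.
have def_g' : {in ts, forall t, g t = if t == s then None else if t == size y then Some y else f
  t}.
  by move=> r r_ts; rewrite def_g // inE r_ts orbT.
have {def_g} gt := def_g t (mem_head _ _).
rewrite ltxi_cons; case def_w: (f t) tog co => [w|] tog co; last first.
  have [sz sub_cut co_cut] := coherent_cut rk le_tv co; case: tog => eq_y.
  rewrite eq_y in sz sub_cut co_cut.
  have ne_s : t != s by apply/eqP=> eq_s; rewrite -eq_s def_w in fs.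
  rewrite (negbTE ne_s) sz eqxx in gt; rewrite gt eq_y lexx /=.
  have {}s_ts : s \in ts by move: s_ts; rewrite inE eq_sym (negbTE ne_s).
  have wo : without f g s ts.
    move=> r r_ts; rewrite def_g' //; case: (r == s) => //; case: eqP => // eq_r.
    by have := lt_t r r_ts; rewrite -sz eq_r ltnn.
  (* Otherwise [toggle g] would stop here on [y], a word present in [g], against [gz]. So the lower
     end has changed, which means that [x] was directly below [y]. *)
  have ne_y : y <> cut v (next g ts) t.
    by move=> eq_yc; move: togg; rewrite gt -eq_yc eqxx => -[eq_z]; rewrite -eq_z sz gt in gz.
  have [eq_n|eq_n] := next_without rk' wo fs; first by rewrite eq_n eq_y in ne_y.
  have [sz_x sub_x] := coherent_rank co_cut s_ts fs.
  (* Were [x] canonical between [y] and the new lower end, [cut_trans] would make [y] canonical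
     above that end too, against [ne_y]. *)
  apply: (key_without rk' co_cut wo s_ts fs eq_n); apply/eqP=> eq_x; apply: ne_y.
  have sub_u := next_without_sub rk' co wo; rewrite eq_n in sub_u eq_y.
  rewrite -eq_y; apply: cut_trans; rewrite ?sz_x ?lt_t //;
    first by apply: subseq_trans sub_x sub_cut.
  by rewrite eq_y.
have /and3P[/eqP sz_w sub_w cow] := co.
move: tog; case: eqP => [eq_w [eq_y]|ne_w tog].
  by rewrite -eq_y -eq_w sz_w def_w in fy.
have [y_ts sub_y _] := toggleP rk' cow tog; have lt_yt := lt_t _ y_ts.
have ne_ty : t != size y by rewrite neq_ltn lt_yt orbT.
rewrite (negbTE ne_ty) def_w in gt.
have [eq_t|ne_t] := eqVneq t s.
  rewrite eq_t eqxx in gt; rewrite eq_t gt in togg *.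
  have def_g2 : {in ts, forall r, g r = if r == size y then Some y else f r}.
    move=> r r_ts; rewrite def_g' // -eq_t; case: eqP => // eq_r.
    by have := lt_t r r_ts; rewrite eq_r ltnn.
  have sub_gw : subseq (next g ts) w.
    by have [->|[-> _ _]] := next_toggle_with rk' cow tog fy def_g2; rewrite ?(next_sub cow).
  (* Here [w] is the deleted word. If it were canonical above [next g ts], it would be so above
     [next f ts], either directly or by [cut_trans] across [y], and [toggle f] would have stopped at
     it. *)
  have ne_w2 : w != cut v (next g ts) (size w).
    apply/eqP=> eq_w; have [eq_n|[eq_n sub_n eq_y]] := next_toggle_with rk' cow tog fy def_g2.
      by rewrite eq_n sz_w in eq_w.
    apply: ne_w; rewrite {1}eq_w eq_n sz_w; apply: cut_trans => //.
      exact: subseq_trans sub_y sub_w.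
    by rewrite -sz_w -eq_n -eq_w eq_n.
  have := cut_min sub_gw sub_w ne_w2; rewrite sz_w !leEnat -eq_t => lt_cost.
  by rewrite (ltnW lt_cost) leqNgt lt_cost.
have {}s_ts : s \in ts by move: s_ts; rewrite inE eq_sym (negbTE ne_t).
rewrite (negbTE ne_t) in gt; rewrite gt lexx /=; apply: (IH w rk' cow tog fy s_ts fs def_g' _ gz).
move: togg; rewrite gt; case: eqP => // eq_w [eq_z].
by rewrite -eq_z -eq_w sz_w gt in gz.
Qed.

End RankFunctions.

(** * Exactness of the rank-selected complex *)

Section RankSelectedExactness.
Variables (A : finType) (k : nat) (T : {set 'I_k.+1}).
Hypotheses (T_pos : ord0 \notin T) (A_gt0 : (0 < #|A|)%N).
Local Notation P := (rank_selected A T).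
Local Notation le := (@subword A k).
Local Open Scope nat_scope.

Lemma subword_anti : antisymmetric le.
Proof.
move=> u v /andP[suv svu]; apply/val_inj/eqP; rewrite -(size_subseq_leqif suv).
by rewrite eqn_leq !size_subseq.
Qed.

Lemma chain_size_inj (c : {set k.-bseq A}) :
  is_chain le P c -> {in c &, injective (fun w : k.-bseq A => size w)}.
Proof.
case/andP=> _ /forall_inP chc u v cu cv eq_sz; have /forall_inP/(_ v cv) := chc u cu.
rewrite /subword => /orP[] sub; apply/val_inj/eqP.
  by rewrite -(size_subseq_leqif sub) eq_sz.
by rewrite eq_sym -(size_subseq_leqif sub) eq_sz.
Qed.

Definition rank_seq : seq nat := rev [seq val i | i <- enum T].

Lemma mem_rank_seq (i : 'I_k.+1) : (val i \in rank_seq) = (i \in T).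
Proof. by rewrite mem_rev mem_map ?mem_enum //; apply: val_inj. Qed.

Lemma rank_seqP (t : nat) : reflect (exists2 i : 'I_k.+1, i \in T & t = i) (t \in rank_seq).
Proof.
rewrite mem_rev; apply: (iffP mapP) => [] [i iT ->]; exists i => //.
  by rewrite mem_enum in iT.
by rewrite mem_enum.
Qed.

Lemma ranks_rank_seq : ranks rank_seq.
Proof.
rewrite /ranks -rev_cons rev_sorted /= (path_sortedE ltn_trans); apply/andP; split.
  apply/allP=> _ /mapP[i + ->]; rewrite mem_enum => iT /=; rewrite lt0n.
  by apply: contraNneq T_pos => i0; rewrite (_ : ord0 = i) //; apply: val_inj.
rewrite sorted_map {1}/enum_mem sorted_filter //; first by move=> x y z; apply: ltn_trans.
by have := iota_ltn_sorted 0 k.+1; rewrite -val_enum_ord sorted_map enumT.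
Qed.

Lemma uniq_rank_seq : uniq rank_seq.
Proof. by rewrite rev_uniq map_inj_uniq ?enum_uniq //; apply: val_inj. Qed.

(* Contains all words of length at most [k], and so plays the role of a top element. *)
Definition universal_word : seq A := flatten (nseq k (enum A)).

Lemma sub_universal_word (w : seq A) : size w <= k -> subseq w universal_word.
Proof.
rewrite /universal_word; elim: w k => [|a w IHw] [|m] //= le_w; first exact: sub0seq.
by rewrite -cat1s cat_subseq ?IHw // sub1seq mem_enum.
Qed.

Lemma size_universal_word : k <= size universal_word.
Proof. by rewrite size_flatten /shape map_nseq sumn_nseq -cardE leq_pmull. Qed.

(** A chain has at most one word of each length, so [pick] makes no real choice. *)
Definition word_at (c : {set k.-bseq A}) (t : nat) : option (seq A) :=
  omap val [pick w in c | size w == t].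

Lemma word_at_some c t x : word_at c t = Some x ->
  exists w : k.-bseq A, [/\ w \in c, size w = t & val w = x].
Proof.
by rewrite /word_at; case: pickP => //= w /andP[cw /eqP sz] [<-]; exists w.
Qed.

Lemma word_at_none c t (w : k.-bseq A) : word_at c t = None -> w \in c -> size w != t.
Proof. by rewrite /word_at; case: pickP => //= nw _ cw; move: (nw w); rewrite cw /= => ->. Qed.

Lemma word_at_mem c (w : k.-bseq A) :
  is_chain le P c -> w \in c -> word_at c (size w) = Some (val w).
Proof.
move=> chc cw; case def_x: (word_at c (size w)) => [x|].
  have [w' [cw' sz <-]] := word_at_some def_x.
  by rewrite (chain_size_inj chc cw' cw sz).
by have := word_at_none def_x cw; rewrite eqxx.
Qed.

Lemma word_atD1 c x t : is_chain le P c -> x \in c ->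
  word_at (c :\ x) t = if t == size x then None else word_at c t.
Proof.
move=> chc cx; have chd : is_chain le P (c :\ x) by apply: is_chainS chc; apply: subsetDl.
case def_y: (word_at (c :\ x) t) => [y|].
  have [w [/setD1P[ne_wx cw] <- <-]] := word_at_some def_y.
  rewrite (word_at_mem chc cw); case: eqP => // eq_sz.
  by rewrite (chain_size_inj chc cw cx eq_sz) eqxx in ne_wx.
case: eqP => // /eqP ne_t; case def_y': (word_at c t) => [y|//].
have [w [cw sz _]] := word_at_some def_y'; have := @word_at_none _ _ w def_y.
rewrite !inE cw sz eqxx andbT; case: eqP => [eq_w|_ /(_ isT)//].
by rewrite -sz eq_w eqxx in ne_t.
Qed.

Lemma word_atU1 c x t : is_chain le P (x |: c) -> x \notin c ->
  word_at (x |: c) t = if t == size x then Some (val x) else word_at c t.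
Proof.
move=> chc ncx; rewrite -{2}[c](setU1K ncx) word_atD1 ?setU11 //; case: eqP => [->|//].
by rewrite word_at_mem ?setU11.
Qed.

Lemma coherentI f v ts : ranks ts -> {in ts, forall t, t <= size v} ->
    {in ts, forall t w, f t = Some w -> size w = t /\ subseq w v} ->
    {in ts &, forall s t x w, f s = Some x -> f t = Some w -> s < t -> subseq x w} ->
  @coherent A f v ts.
Proof.
elim: ts v => //= t ts IH v /ranks_cons[rk lt_t] le_v sub_v sub_f.
have inS s : s \in ts -> s \in t :: ts by move=> s_ts; rewrite inE s_ts orbT.
rewrite le_v ?mem_head //; case def_w: (f t) => [w|] /=.
  have [sz sub] := sub_v t (mem_head _ _) w def_w; rewrite sz eqxx sub /=.
  apply: IH => // [s s_ts|s s_ts x fs|r s r_ts s_ts]; last by apply: sub_f; apply: inS.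
    by rewrite sz ltnW // lt_t.
  have [-> _] := sub_v s (inS s s_ts) x fs; split=> //.
  by apply: (sub_f s t (inS s s_ts) (mem_head _ _)) fs def_w _; apply: lt_t.
apply: IH => // [s s_ts|s s_ts|r s r_ts s_ts];
  [exact/le_v/inS | exact/sub_v/inS | by apply: sub_f; apply: inS].
Qed.

Lemma chain_coherent c : is_chain le P c -> coherent (word_at c) universal_word rank_seq.
Proof.
move=> chc; apply: coherentI => [|t /rank_seqP[i _ ->]|t _ w|s t _ _ x w].
- exact: ranks_rank_seq.
- by apply: leq_trans size_universal_word; rewrite -ltnS.
- move/word_at_some=> [w' [cw' <- <-]]; split=> //; apply: sub_universal_word.
  exact: size_bseq.
move=> /word_at_some[x' [cx' <- <-]] /word_at_some[w' [cw' <- <-]] lt_xw.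
case/andP: chc => _ /forall_inP/(_ x' cx')/forall_inP/(_ w' cw') /orP[]//.
by move/size_subseq; rewrite leqNgt lt_xw.
Qed.

Lemma chain_setU1 c w : is_chain le P c -> w \in P ->
  {in c, forall u, le u w || le w u} -> is_chain le P (w |: c).
Proof.
case/andP=> scP /forall_inP chc sw cmp.
apply/andP; split; first by rewrite subUset sub1set sw.
apply/forall_inP=> u /setU1P[->|cu]; apply/forall_inP=> v /setU1P[->|cv].
- by rewrite /subword subseq_refl.
- by rewrite orbC cmp.
- by rewrite cmp.
by have /forall_inP/(_ v cv) := chc u cu.
Qed.

Definition toggled (c : {set k.-bseq A}) : option (seq A) :=
  toggle (word_at c) universal_word rank_seq.

Definition toggle_absent (c : {set k.-bseq A}) : bool :=
  if toggled c is Some y then word_at c (size y) == None else false.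

(** For a chain the default of [insubd] never occurs, since a toggled word has a selected rank,
    hence length at most [k]. *)
Definition add_toggled (c : {set k.-bseq A}) : {set k.-bseq A} :=
  if toggled c is Some y then insubd [bseq] y |: c else c.

Lemma toggled_bseq c y : is_chain le P c -> toggled c = Some y ->
  val (insubd [bseq] y : k.-bseq A) = y.
Proof.
move=> chc /(toggleP ranks_rank_seq (chain_coherent chc))[/rank_seqP[i _ sz] _ _].
by rewrite val_insubd sz -ltnS ltn_ord.
Qed.

Lemma toggled_mem c y : is_chain le P c -> toggled c = Some y ->
  (insubd [bseq] y : k.-bseq A) \in P.
Proof.
move=> chc tog; rewrite inE; apply/existsP.
have [/rank_seqP[i iT sz] _ _] := toggleP ranks_rank_seq (chain_coherent chc) tog.
by exists i; rewrite iT (toggled_bseq chc tog) sz eqxx.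
Qed.

Lemma toggle_absentP c : is_chain le P c -> toggle_absent c ->
  exists w : k.-bseq A, [/\ toggled c = Some (val w), w \notin c,
    word_at c (size w) = None, add_toggled c = w |: c & is_chain le P (w |: c)].
Proof.
move=> chc; rewrite /toggle_absent /add_toggled; case tog: (toggled c) => [y|//] /eqP at_y.
have sw := toggled_mem chc tog; have val_w := toggled_bseq chc tog.
move: (insubd _ _) => w in sw val_w *; rewrite -{}val_w in tog at_y *.
have ncw : w \notin c by apply/negP => /(word_at_none at_y); rewrite eqxx.
exists w; split=> //; apply: chain_setU1 => // u cu.
have su : size u \in rank_seq.
  case/andP: (chc) => /subsetP/(_ u cu) + _; rewrite inE => /existsP[i /andP[iT /eqP->]].
  by rewrite mem_rank_seq.
exact: toggle_comparable ranks_rank_seq (chain_coherent chc) tog su (word_at_mem chc cu).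
Qed.

Local Notation simplices := (simplices le P).

Lemma simplexP j c : c \in simplices j -> is_chain le P c /\ #|c| = j.
Proof. by rewrite inE => /andP[-> /eqP]. Qed.

Lemma chain_ranks c : is_chain le P c ->
  {subset [seq size (w : k.-bseq A) | w <- enum c] <= rank_seq}.
Proof.
move=> chc _ /mapP[w + ->]; rewrite mem_enum => cw.
case/andP: chc => /subsetP/(_ w cw) + _; rewrite inE => /existsP[i /andP[iT /eqP->]].
by rewrite mem_rank_seq.
Qed.

Lemma chain_ranks_uniq c : is_chain le P c -> uniq [seq size (w : k.-bseq A) | w <- enum c].
Proof.
move=> chc; rewrite map_inj_in_uniq ?enum_uniq // => u v; rewrite !mem_enum.
exact: (chain_size_inj chc).
Qed.

Lemma card_chain_le c : is_chain le P c -> #|c| <= #|T|.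
Proof.
move=> chc; have := uniq_leq_size (chain_ranks_uniq chc) (chain_ranks chc).
by rewrite size_rev !size_map -!cardE.
Qed.

(** A chain short of a rank has a toggled word, as [toggle] yields [None] only when all ranks are
    filled; if that word is present, deleting it gives the partner. Only top-dimensional simplices
    can stay unmatched. *)
Lemma toggle_present c : is_chain le P c -> #|c| < #|T| -> ~~ toggle_absent c ->
  exists2 w : k.-bseq A, w \in c & toggle_absent (c :\ w) /\ add_toggled (c :\ w) = c.
Proof.
move=> chc lt_cT; rewrite {1}/toggle_absent; case tog: (toggled c) => [y|]; last first.
  move=> _; have none := toggle_none tog;
    have : {subset rank_seq <= [seq size (w : k.-bseq A) | w <- enum c]}.
    move=> t /none; case def_y: (word_at c t) => [y|] // _.
    by have [w [cw <- _]] := word_at_some def_y; apply/mapP; exists w; rewrite ?mem_enum.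
  move/(uniq_leq_size uniq_rank_seq); rewrite size_rev !size_map -!cardE.
  by rewrite leqNgt lt_cT.
have [_ _ [->//|at_y _]] := toggleP ranks_rank_seq (chain_coherent chc) tog.
have [w [cw sz_w val_w]] := word_at_some at_y; rewrite -{}val_w in tog at_y.
have chd : is_chain le P (c :\ w) by apply: is_chainS chc; apply: subsetDl.
have togd : toggled (c :\ w) = Some (val w).
  apply: toggle_without (ranks_rank_seq) (chain_coherent chc) tog at_y _ => t _.
  exact: word_atD1.
exists w => //; rewrite /toggle_absent /add_toggled togd word_atD1 // eqxx; split=> //.
by rewrite valKd setD1K.
Qed.

(** Equal cardinalities force [c] to be [c'] with its toggled word added and one other word removed,
    which is the situation of [key_toggle]. *)
Lemma matching_key j c c' : c \in simplices j -> c' \in simplices j ->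
    toggle_absent c -> toggle_absent c' -> c != c' -> c \subset add_toggled c' ->
  (chain_key (word_at c) universal_word rank_seq < chain_key (word_at c') universal_word
    rank_seq)%O.
Proof.
move=> /simplexP[chc card_c] /simplexP[chc' card_c'] absc absc' ne_cc' sub.
have [z [togz ncz at_z _ _]] := toggle_absentP chc absc.
have [y [togy ncy at_y eq_up chu]] := toggle_absentP chc' absc'; rewrite eq_up in sub.
have /cards1P[x def_x] : #|(y |: c') :\: c| == 1.
  by rewrite cardsD (setIidPr sub) cardsU1 ncy card_c card_c' addnK.
have /setDP[ux ncx] : x \in (y |: c') :\: c by rewrite def_x inE.
have eqc : c = (y |: c') :\ x by rewrite -def_x setDDr setDv set0U (setIidPr sub).
have ne_xy : x != y.
  by apply: contraNneq ne_cc' => eq_xy; rewrite eqc eq_xy setU1K.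
have c'x : x \in c' by move: ux; rewrite !inE (negbTE ne_xy).
apply: (key_toggle ranks_rank_seq (chain_coherent chc') togy at_y _ (word_at_mem chc' c'x) _
  togz at_z).
  by apply: (chain_ranks chc'); apply/mapP; exists x; rewrite ?mem_enum.
by move=> t _; rewrite eqc word_atD1 // word_atU1.
Qed.

Variable F : numFieldType.

Lemma add_toggled_simplex j c : c \in simplices j -> toggle_absent c ->
  add_toggled c \in simplices j.+1.
Proof.
move=> /simplexP[chc card_c] absc; have [z [_ ncz _ -> chu]] := toggle_absentP chc absc.
by rewrite inE chu cardsU1 ncz card_c eqxx.
Qed.

Lemma add_toggled_sub j c : c \in simplices j -> toggle_absent c -> c \subset add_toggled c.
Proof.
move=> /simplexP[chc card_c] absc; have [z [_ _ _ -> _]] := toggle_absentP chc absc.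
exact: subsetUr.
Qed.

Lemma rank_selected_exact0 : T != set0 -> (1%:M <= boundary F le P 0)%MS.
Proof.
move=> T_neq0; apply: (matching_exact0 _ add_toggled_simplex add_toggled_sub matching_key).
move=> c /simplexP[chc card_c]; apply: contraT => pres.
have [|w] := toggle_present chc _ pres; first by rewrite card_c card_gt0.
by move: card_c => /eqP; rewrite cards_eq0 => /eqP->; rewrite inE.
Qed.

Lemma rank_selected_exact j : j.+1 < #|T| ->
  (kermx (boundary F le P j) <= boundary F le P j.+1)%MS.
Proof.
move=> lt_jT; apply: (matching_exact _ subword_anti add_toggled_simplex add_toggled_sub
  matching_key).
move=> c sc pres; have [chc card_c] := simplexP sc.
have [|w cw [abs eq_c]] := toggle_present chc _ pres; first by rewrite card_c.
by exists (c :\ w); first exact: simplicesD1.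
Qed.

Lemma rank_selected_top : simplices #|T|.+1 = set0.
Proof.
apply/setP=> c; rewrite [RHS]inE; apply/negP => /simplexP[chc card_c].
by have := card_chain_le chc; rewrite card_c ltnn.
Qed.

End RankSelectedExactness.

(** * Counting chains *)

Section ChainPolynomials.
Implicit Types (a b t : nat) (ts : seq nat).

(* Evaluated at [x - 1], the number of words of length [b] over [x] letters that contain a
   given word of length [a]; the recursion distinguishes whether the first letters agree. *)
Fixpoint superword_poly b a : {poly int} :=
  if b is b'.+1 then
    if a is a'.+1 then superword_poly b' a' + 'X * superword_poly b' a
    else (1 + 'X) ^+ b
  else (a == 0%N)%:R.

(** The lowest word need only contain the empty word, whence the default rank 0. *)
Fixpoint chain_poly ts : {poly int} :=
  if ts is t :: ts' then superword_poly t (head 0%N ts') * chain_poly ts' else 1.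

Lemma coefM_ge0 (p q : {poly int}) :
  (forall i, 0 <= p`_i) -> (forall i, 0 <= q`_i) -> forall i, 0 <= (p * q)`_i.
Proof. by move=> p0 q0 i; rewrite coefM sumr_ge0 // => j _; rewrite mulr_ge0. Qed.

Lemma superword_poly_ge0 b a i : 0 <= (superword_poly b a)`_i.
Proof.
elim: b a i => [|b IHb] a i /=; first by case: a => [|a]; rewrite ?coef1 ?coef0.
case: a => [|a].
  elim: b.+1 i => [|n IHn] i; first by rewrite expr0 coef1; case: eqP.
  rewrite exprS mulrDl mul1r coefD addr_ge0 //.
  by apply: coefM_ge0 => {}i //; rewrite coefX; case: eqP.
by rewrite coefD addr_ge0 //; apply: coefM_ge0 => {}i //; rewrite coefX; case: eqP.
Qed.

Lemma chain_poly_ge0 ts i : 0 <= (chain_poly ts)`_i.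
Proof.
elim: ts i => [|t ts IH] i /=; first by rewrite coef1; case: eqP.
by apply: coefM_ge0 => // ?; apply: superword_poly_ge0.
Qed.

Lemma superword_poly_eq0 b a : (b < a)%N -> superword_poly b a = 0.
Proof.
elim: b a => [|b IHb] [|a] //= ltba.
by rewrite !IHb ?mulr0 ?addr0 // ltnW.
Qed.

Lemma size_superword_poly b a : (size (superword_poly b a) <= (b - a).+1)%N.
Proof.
have sizeX b' : (size ((1 + 'X) ^+ b' : {poly int}) <= b'.+1)%N.
  by rewrite (leq_trans (size_poly_exp_leq _ _)) // addrC -polyC1 size_XaddC mul1n.
elim: b a => [|b IHb] [|a] /=; rewrite ?size_poly1 ?size_poly0 ?subn0 //.
have [le_ab | lt_ba] := leqP a.+1 b; last first.
  by rewrite (superword_poly_eq0 lt_ba) mulr0 addr0 subSS.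
rewrite subSS; apply: leq_trans (size_polyD _ _) _; rewrite geq_max IHb /=.
apply: leq_trans (size_polyMleq _ _) _; rewrite size_polyX /= add1n.
by apply: leq_trans (IHb _) _; rewrite subnS prednK ?leqnn // subn_gt0.
Qed.

(** The degrees of the factors, differences of consecutive ranks, telescope to the largest rank. *)
Lemma size_chain_poly ts : ranks ts -> (size (chain_poly ts) <= (head 0%N ts).+1)%N.
Proof.
elim: ts => [|t ts IH] rk; rewrite ?size_poly1 //=.
have [rk' lt_t] := ranks_cons rk; apply: leq_trans (size_polyMleq _ _) _.
have le_ht : (head 0%N ts <= t)%N by case: (ts) lt_t => //= s ts' lt_t;
  rewrite ltnW // lt_t ?mem_head.
have := leq_add (size_superword_poly t (head 0%N ts)) (IH rk').
move: (size _) (size _) le_ht => x y; lia.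
Qed.

(** Evaluation at 0 counts over a one-letter alphabet, which has one word of each length. *)
Lemma superword_poly_at0 b a : (a <= b)%N -> (superword_poly b a).[0] = 1.
Proof.
elim: b a => [|b IHb] [|a] //= le_ab; rewrite ?hornerE ?expr1n //.
by rewrite IHb ?hornerE.
Qed.

Lemma chain_poly_at0 ts : ranks ts -> (chain_poly ts).[0] = 1.
Proof.
elim: ts => [|t ts IH] rk /=; first by rewrite hornerC.
have [rk' lt_t] := ranks_cons rk; rewrite hornerM IH // mulr1 superword_poly_at0 //.
by case: (ts) lt_t => //= s ts' lt_t; rewrite ltnW // lt_t ?mem_head.
Qed.

End ChainPolynomials.

Section CountingWords.
Variables (A : finType) (B : {set A}).
Local Notation letters := (enum B).

Fixpoint words (b : nat) : seq (seq A) :=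
  if b is b'.+1 then [seq a :: w | a <- letters, w <- words b'] else [:: [::]].

Lemma mem_words b w : (w \in words b) = (size w == b) && all [in B] w.
Proof.
elim: b w => [|b IHb] w /=; first by rewrite inE; case: w.
apply/allpairsP/idP => [[[a v] /= [aB vb ->]]|].
  by rewrite /= eqSS; rewrite mem_enum in aB; rewrite aB -IHb.
case: w => //= a v; rewrite eqSS andbCA => /andP[aB vb].
by exists (a, v); rewrite /= mem_enum IHb.
Qed.

Lemma uniq_words b : uniq (words b).
Proof.
elim: b => //= b IHb; apply: allpairs_uniq; rewrite ?enum_uniq //.
by move=> [a v] [a' v'] _ _ [-> ->].
Qed.

Lemma count_words_cons (p : pred (seq A)) b :
  count p (words b.+1) = (\sum_(a <- letters) count (p \o cons a) (words b))%N.
Proof.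
rewrite /= count_flatten -map_comp sumnE big_map; apply: eq_bigr => a _.
by rewrite /= count_map.
Qed.

(** The evaluation takes place in [int] because [B] may be empty, as for a derangement; the point is
    then -1, and only the empty [u] remains. *)
Lemma count_words b (u : seq A) : all [in B] u ->
  (count (subseq u) (words b))%:Z = (superword_poly b (size u)).[#|B|%:Z - 1].
Proof.
elim: b u => [|b IHb] [|x u] /=; rewrite ?hornerC //.
  move=> _; rewrite -/(words b.+1).
  have -> : count (subseq [::]) (words b.+1) = (#|B| ^ b.+1)%N.
    rewrite (eq_count (a2 := predT)) ?count_predT; last by move=> w; rewrite sub0seq.
    elim: b.+1 => //= m IHm; rewrite size_allpairs IHm expnS -cardE //.
  by rewrite horner_exp hornerD hornerX hornerC subrKC -natz natrX natz.
case/andP=> xB uB; rewrite -/(words b.+1) count_words_cons.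
rewrite (bigD1_seq x) ?mem_enum ?enum_uniq //= (eq_count (a2 := subseq u)); last first.
  by move=> w /=; rewrite eqxx.
rewrite (eq_bigr (fun _ => count (subseq (x :: u)) (words b))); last first.
  by move=> a ne_ax; apply: eq_count => w /=; rewrite eq_sym (negbTE ne_ax).
rewrite big_const_seq iter_addn_0.
have : (count (pred1 x) letters + count (fun a => a != x) letters = #|B|)%N.
  by rewrite count_predC cardE.
rewrite count_uniq_mem ?enum_uniq // mem_enum xB => eqB.
have xuB : all [in B] (x :: u) by rewrite /= xB.
rewrite hornerD hornerM hornerX -(IHb u uB) -(IHb _ xuB) PoszD PoszM [in RHS]mulrC.
by rewrite -eqB PoszD (addrC 1%:Z) addrK.
Qed.

(* Chains are listed downwards: the first word has the largest rank. *)
Fixpoint chain_lists (ts : seq nat) : seq (seq (seq A)) :=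
  if ts is t :: ts' then
    [seq w :: c | c <- chain_lists ts', w <- filter (subseq (head [::] c)) (words t)]
  else [:: [::]].

Lemma mem_chain_lists ts c :
  (c \in chain_lists ts) =
  [&& map size c == ts, all (all [in B]) c & sorted (fun w u => subseq u w) c].
Proof.
elim: ts c => [|t ts IH] c /=; first by rewrite inE; case: c.
apply/allpairsPdep/idP => [[c' [w [cc' + ->]]]|].
  rewrite mem_filter mem_words => /andP[sub /andP[/eqP sz wB]].
  move: cc'; rewrite IH /= => /and3P[/eqP-> -> srt]; rewrite sz eqxx wB /=.
  by case: c' sub srt => //= v c' -> ->.
case: c => //= w c /and3P[/eqP[sz eq_ts] /andP[wB cB] srt].
exists c, w; split=> //; last first.
  rewrite mem_filter mem_words sz eqxx wB /= andbT; case: (c) srt => /=; first by rewrite sub0seq.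
  by move=> v c' /andP[].
by rewrite IH eq_ts eqxx cB (path_sorted srt).
Qed.

Lemma uniq_chain_lists ts : uniq (chain_lists ts).
Proof.
elim: ts => //= t ts IH; apply: allpairs_uniq_dep => // [c _|].
  by rewrite filter_uniq ?uniq_words.
by move=> [c w] [c' w'] _ _ /= [-> ->].
Qed.

Lemma size_chain_lists ts :
  (size (chain_lists ts))%:Z = (chain_poly ts).[#|B|%:Z - 1].
Proof.
elim: ts => [|t ts IH] /=; first by rewrite hornerE.
rewrite size_allpairs_dep hornerM -IH sumnE big_map (big_morph Posz PoszD (erefl 0)).
rewrite (eq_big_seq (fun=> (superword_poly t (head 0%N ts)).[#|B|%:Z - 1])) => [|c]; last first.
  rewrite mem_chain_lists => /and3P[/eqP <- cB _]; rewrite size_filter count_words; last first.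
    by case: (c) cB => //= w c' /andP[].
  by case: (c).
by rewrite big_const_seq count_predT iter_addr addr0 -mulr_natr natz.
Qed.

End CountingWords.

Section FixedMaxChains.
Variables (A : finType) (k : nat) (S : {set 'I_k.+1}).
Hypotheses (S_pos : ord0 \notin S) (A_gt0 : (0 < #|A|)%N).
Local Notation P := (rank_selected A S).
Local Notation le := (@subword A k).
Local Notation rs := (rank_seq S).
Local Open Scope nat_scope.

Lemma chain_missing_rank c : is_chain le P c -> #|c| < #|S| ->
  exists2 t, t \in rs & word_at c t = None.
Proof.
move=> chc lt_c; have [/allP all_at|/allPn[t t_rs]] := boolP (all (fun t =>
  word_at c t != None) rs).
  have sub : {subset rs <= [seq size (w : k.-bseq A) | w <- enum c]}.
    move=> t /all_at; case def_y: (word_at c t) => [y|//] _.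
    by have [w [cw <- _]] := word_at_some def_y; apply/mapP; exists w; rewrite ?mem_enum.
  have := uniq_leq_size (uniq_rank_seq S) sub.
  by rewrite size_rev !size_map -!cardE leqNgt lt_c.
by rewrite negbK => /eqP; exists t.
Qed.

Lemma mem_max_chains c :
  (c \in max_chains le P) = is_chain le P c && (#|c| == #|S|).
Proof.
rewrite inE; apply/maxsetP/andP => [[chc maxc]|[chc /eqP card_c]]; split=> //; last first.
  move=> b chb sub; apply/esym/eqP; rewrite eqEcard sub card_c.
  exact: card_chain_le.
rewrite eqn_leq card_chain_le //= leqNgt; apply/negP => lt_c.
have [t t_rs at_t] := chain_missing_rank chc lt_c.
have [y [sz_y sub_y cmp]] := coherent_extend (ranks_rank_seq S_pos)
  (chain_coherent S_pos A_gt0 chc) t_rs at_t.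
have /rank_seqP[i iS eq_t] := t_rs.
have [w val_w] : exists w : k.-bseq A, val w = y.
  by exists (insubd [bseq] y); rewrite val_insubd sz_y eq_t -ltnS ltn_ord.
have ncw : w \notin c by apply/negP => /(word_at_none at_t); rewrite val_w sz_y eqxx.
suff chwc : is_chain le P (w |: c).
  by case/negP: ncw; rewrite -(maxc _ chwc (subsetUr _ _)) setU11.
apply: chain_setU1 => //; first by rewrite inE; apply/existsP; exists i;
  rewrite iS val_w sz_y eq_t eqxx.
move=> u cu; rewrite /subword val_w; apply: (cmp (size u)); last exact: (word_at_mem chc cu).
by apply: (chain_ranks chc); apply/mapP; exists u; rewrite ?mem_enum.
Qed.

Variable g : {perm A}.
Definition fixed_letters : {set A} := [set a | g a == a].
Local Notation B := fixed_letters.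

(** Permuting letters preserves lengths, and a chain has at most one word of each, so a fixed chain
    is fixed word by word and hence letter by letter. *)
Lemma chain_fixed c : is_chain le P c ->
  (setact (word_action A k) c g == c) = [forall w in c, all [in B] (w : k.-bseq A)].
Proof.
move=> chc; apply/eqP/forall_inP => [fix_c w cw|fix_c].
  have cgw : word_action A k w g \in c by rewrite -fix_c; apply: imset_f.
  have /(congr1 val)/= := chain_size_inj chc cgw cw (size_map _ _).
  move=> eq_w; apply/allP=> a aw; rewrite inE.
  move: eq_w => /eqP; rewrite -{2}[val w]map_id => /eqP/eq_in_map/(_ a aw) ->//.
rewrite -[RHS]imset_id; apply: eq_in_imset => w cw; apply: val_inj => /=.
rewrite -[RHS]map_id; apply/eq_in_map=> a /(allP (fix_c w cw)).
by rewrite inE => /eqP.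
Qed.

Definition chain_list (c : {set k.-bseq A}) : seq (seq A) :=
  [seq odflt [::] (word_at c t) | t <- rs].

Lemma full_chain_at c t : is_chain le P c -> #|c| = #|S| -> t \in rs ->
  exists2 w : k.-bseq A, w \in c & word_at c t = Some (val w) /\ size w = t.
Proof.
move=> chc card_c t_rs; case def_x: (word_at c t) => [x|].
  by have [w [cw sz <-]] := word_at_some def_x; exists w.
have sub := chain_ranks chc; have uniq_c := chain_ranks_uniq chc.
have : t \in [seq size (w : k.-bseq A) | w <- enum c].
  have [|_ ->//] := uniq_min_size uniq_c sub.
  by rewrite size_rev !size_map -!cardE card_c.
case/mapP=> w; rewrite mem_enum => cw eq_t.
by have := word_at_none def_x cw; rewrite eq_t eqxx.
Qed.

Lemma mem_chain_list c (w : k.-bseq A) : is_chain le P c -> #|c| = #|S| ->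
  (val w \in chain_list c) = (w \in c).
Proof.
move=> chc card_c; apply/mapP/idP => [[t t_rs eq_w]|cw].
  have [w' cw' [at_t _]] := full_chain_at chc card_c t_rs.
  by rewrite at_t /= in eq_w; rewrite (val_inj eq_w).
exists (size w); last by rewrite (word_at_mem chc cw).
by apply: (chain_ranks chc); apply/mapP; exists w; rewrite ?mem_enum.
Qed.

Lemma chain_list_mem c : is_chain le P c -> #|c| = #|S| ->
  [forall w in c, all [in B] (w : k.-bseq A)] -> chain_list c \in chain_lists B rs.
Proof.
move=> chc card_c /forall_inP cB; rewrite mem_chain_lists; apply/and3P; split.
- rewrite -map_comp; apply/eqP; rewrite -[RHS]map_id; apply/eq_in_map => t t_rs /=.
  by have [w cw [-> <-]] := full_chain_at chc card_c t_rs.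
- apply/allP=> _ /mapP[t t_rs ->].
  by have [w cw [-> _]] := full_chain_at chc card_c t_rs; apply: cB.
rewrite sorted_map; have rk := ranks_rank_seq S_pos.
have srt : sorted gtn rs.
  by move: rk; rewrite /ranks -cats1 => /cat_sorted2[].
apply: (@sub_in_sorted _ [in rs] gtn) srt; last exact/allP.
move=> t t' t_rs t'_rs /= lt_t.
have [w cw [-> sz]] := full_chain_at chc card_c t_rs.
have [w' cw' [-> sz']] := full_chain_at chc card_c t'_rs.
case/andP: chc => _ /forall_inP/(_ w cw)/forall_inP/(_ w' cw') /orP[]//.
by move/size_subseq; rewrite sz sz' leqNgt lt_t.
Qed.

Lemma chain_of_list l : l \in chain_lists B rs ->
  exists c, [/\ is_chain le P c, #|c| = #|S|,
    [forall w in c, all [in B] (w : k.-bseq A)] & chain_list c = l].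
Proof.
rewrite mem_chain_lists => /and3P[/eqP sz_l /allP lB srt].
have uniq_l : uniq l by apply: (@map_uniq _ _ size); rewrite sz_l uniq_rank_seq.
have size_l x : x \in l -> size x \in rs by move=> lx; rewrite -sz_l map_f.
have bseq_l x : x \in l -> exists2 w : k.-bseq A, w \in [set w :
  k.-bseq A | val w \in l] & val w = x.
  move=> lx; have /rank_seqP[i _ eq_i] := size_l x lx.
  have val_x : val (insubd [bseq] x : k.-bseq A) = x.
    by rewrite val_insubd eq_i -ltnS ltn_ord.
  by exists (insubd [bseq] x); rewrite ?inE val_x.
set c := [set w : k.-bseq A | val w \in l] in bseq_l.
have chc : is_chain le P c.
  apply/andP; split.
    apply/subsetP=> w; rewrite !inE => /size_l/rank_seqP[i iS /eqP eq_i].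
    by apply/existsP; exists i; rewrite iS.
  apply/forall_inP=> u; rewrite inE => lu; apply/forall_inP=> v; rewrite inE => lv.
  have trans : transitive (fun x y : seq A => subseq y x).
    by move=> x y z yx zy; apply: subseq_trans zy yx.
  have refl : reflexive (fun x y : seq A => subseq y x) by move=> x; apply: subseq_refl.
  have := sorted_leq_nth trans refl [::] srt.
  move=> nth_l; have := leq_total (index (val u) l) (index (val v) l).
  by case/orP=> /nth_l; rewrite !inE !index_mem lu lv !nth_index // => /(_ isT isT);
    rewrite /subword => ->; rewrite ?orbT.
have card_c : #|c| = #|S|.
  rewrite cardE -(size_map val) (_ : size _ = size l); last first.
    apply/perm_size/uniq_perm; rewrite ?map_inj_uniq ?enum_uniq //; first exact: val_inj.
    move=> x; apply/mapP/idP => [[w + ->]|/bseq_l[w cw <-]]; first by rewrite mem_enum inE.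
    by exists w; rewrite ?mem_enum.
  by rewrite -(size_map size l) sz_l size_rev size_map -cardE.
exists c; split=> //.
  by apply/forall_inP=> w; rewrite inE => /lB.
rewrite /chain_list -sz_l -map_comp -[RHS]map_id; apply/eq_in_map=> x /bseq_l[w cw <-] /=.
by rewrite (word_at_mem chc cw).
Qed.

Lemma card_fixed_max_chains :
  #|[set c in max_chains le P | setact (word_action A k) c g == c]|%:Z =
    (chain_poly rs).[#|B|%:Z - 1]%R.
Proof.
rewrite -size_chain_lists; congr Posz; set C := [set c in _ | _].
have memC c : c \in C -> [/\ is_chain le P c, #|c| = #|S| & [forall w in c, all [in B] (w :
  k.-bseq A)]].
  by rewrite inE mem_max_chains => /andP[/andP[chc /eqP->]]; rewrite chain_fixed.
rewrite cardE -(size_map chain_list); apply/perm_size/uniq_perm.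
- rewrite map_inj_in_uniq ?enum_uniq // => c c'; rewrite !mem_enum.
  move=> /memC[chc card_c _] /memC[chc' card_c' _] eq_l; apply/setP=> w.
  by rewrite -mem_chain_list // eq_l mem_chain_list.
- exact: uniq_chain_lists.
move=> l; apply/mapP/idP => [[c + ->]|/chain_of_list[c [chc card_c cB eq_l]]].
  by rewrite mem_enum => /memC[chc card_c cB]; apply: chain_list_mem.
by exists c; rewrite // mem_enum inE mem_max_chains chc card_c eqxx chain_fixed.
Qed.

End FixedMaxChains.

(** * Traces on chains and homology *)

Section WordTraces.
Variables (F : numFieldType) (A : finType) (k : nat).
Hypothesis A_gt0 : (0 < #|A|)%N.
Local Notation le := (@subword A k).

(** The passage from the flag f-vector to the flag h-vector, with polynomials in place of
    numbers. *)
Definition homology_poly (T : {set 'I_k.+1}) : {poly int} :=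
  \sum_(S : {set 'I_k.+1} | S \subset T) (-1) ^+ (#|T| - #|S|) * chain_poly (rank_seq S).

Lemma max_chain_trace (S : {set 'I_k.+1}) g : ord0 \notin S ->
  \tr (word_max_chain_repr F A S g) =
    ((chain_poly (rank_seq S)).[#|fixed_letters g|%:Z - 1])%:~R.
Proof.
move=> S_pos; rewrite -(card_fixed_max_chains S_pos A_gt0) mxtrace_permmod.
by rewrite -pmulrn.
Qed.

Definition chain_rank_set (c : {set k.-bseq A}) : {set 'I_k.+1} :=
  [set i : 'I_k.+1 | [exists w in c, size (w : k.-bseq A) == i]].

(** Each simplex of the complex for [T] is a maximal chain for its own rank set; this splits the
    chain spaces of one complex into the modules of the first claim. *)
Lemma chain_rank_setP (T S : {set 'I_k.+1}) c j : ord0 \notin T -> S \subset T ->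
  (c \in simplices le (rank_selected A T) j) && (chain_rank_set c == S) =
  (c \in max_chains le (rank_selected A S)) && (#|S| == j).
Proof.
move=> T_pos sST; have S_pos : ord0 \notin S by apply: contra T_pos; apply: (subsetP sST).
have card_ranks U : is_chain le (rank_selected A U) c -> #|chain_rank_set c| = #|c|.
  move=> chc; pose r (w : k.-bseq A) : 'I_k.+1 := inord (size w).
  have rE w : val (r w) = size w by rewrite /= inordK // ltnS size_bseq.
  have -> : chain_rank_set c = r @: c.
    apply/setP=> i; rewrite inE; apply/exists_inP/imsetP => [[w cw /eqP eq_i]|[w cw ->]].
      by exists w => //; apply: val_inj; rewrite /= rE.
    by exists w; rewrite // -rE.
  rewrite card_in_imset // => u v cu cv eq_r; apply: (chain_size_inj chc cu cv).
  by rewrite -!rE eq_r.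
rewrite (mem_max_chains S_pos A_gt0) inE; apply/idP/idP.
  move=> /andP[/andP[chT /eqP card_c] /eqP eq_S]; have := card_ranks _ chT.
  rewrite eq_S card_c => card_S; rewrite card_S !eqxx !andbT.
  case/andP: chT => _ ch; apply/andP; split=> //.
  apply/subsetP=> w cw; rewrite inE; apply/exists_inP.
  have lt_w : (size w < k.+1)%N by rewrite ltnS size_bseq.
  exists (Ordinal lt_w) => //; rewrite -eq_S inE; apply/exists_inP.
  by exists w.
move=> /andP[/andP[chS /eqP card_c] /eqP card_S].
have chT : is_chain le (rank_selected A T) c.
  case/andP: chS => /subsetP sc ch; apply/andP; split=> //; apply/subsetP=> w /sc.
  by rewrite !inE => /exists_inP[i iS eq_i]; apply/exists_inP; exists i => //;
    apply: (subsetP sST).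
rewrite chT card_c card_S eqxx /= eqEcard (card_ranks _ chT) card_c leqnn andbT.
apply/subsetP=> i; rewrite inE => /exists_inP[w cw /eqP eq_i].
case/andP: chS => /subsetP/(_ w cw) + _; rewrite inE => /exists_inP[i' i'S /eqP eq_i'].
by rewrite (_ : i = i') //; apply: val_inj; rewrite /= -eq_i -eq_i'.
Qed.

Lemma simplex_trace (T : {set 'I_k.+1}) j g : ord0 \notin T ->
  \tr (simplex_repr F (@subword_act A k) (acts_rank_selected A T) j g) =
  \sum_(S : {set 'I_k.+1} | (S \subset T) && (#|S| == j))
     ((chain_poly (rank_seq S)).[#|fixed_letters g|%:Z - 1])%:~R.
Proof.
move=> T_pos; rewrite mxtrace_permmod -sum1_card natr_sum.
have sub c : c \in simplices le (rank_selected A T) j -> chain_rank_set c \subset T.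
  rewrite inE => /andP[/andP[/subsetP sc _] _]; apply/subsetP=> i; rewrite inE.
  case/exists_inP=> w /sc; rewrite inE => /exists_inP[i' i'T /eqP->] /eqP eq_i.
  by rewrite -(val_inj eq_i).
rewrite (partition_big chain_rank_set (fun S => (S \subset T) && (#|S| == j))) /=; last first.
  move=> c; rewrite inE => /andP[sc _]; have sST := sub c sc; rewrite sST /=.
  by have := chain_rank_setP c j T_pos sST; rewrite sc eqxx => /esym/andP[].
apply: eq_bigr => S /andP[sST card_S].
have S_pos : ord0 \notin S by apply: contra T_pos; apply: (subsetP sST).
rewrite -(card_fixed_max_chains S_pos A_gt0) -pmulrn -sum1_card natr_sum; apply: eq_bigl => c.
by rewrite 2!in_set andbAC chain_rank_setP // card_S andbT.
Qed.

Lemma homology_trace (T : {set 'I_k.+1}) g : ord0 \notin T -> T != set0 ->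
  \tr (word_homology_repr F A T #|T|.-1 g) =
    ((homology_poly T).[#|fixed_letters g|%:Z - 1])%:~R.
Proof.
move=> T_pos T_neq0; have card_T : #|T|.-1.+1 = #|T| by rewrite prednK // card_gt0.
rewrite /word_homology_repr homology_top_trace; last first.
- by move=> j lt_j; apply: rank_selected_exact => //; rewrite -card_T.
- exact: rank_selected_exact0.
- by rewrite card_T; apply: rank_selected_top.
- exact: subword_anti.
rewrite card_T /homology_poly horner_sum rmorph_sum /=.
(* Groups the subsets by cardinality; [inord] loses nothing because [#|S| <= #|T|]. *)
rewrite (partition_big (fun S : {set 'I_k.+1} => inord #|S| : 'I_#|T|.+1) predT) //=.
apply: eq_bigr => j _; rewrite simplex_trace // mulr_sumr; apply: eq_big => [S|S /andP[_ /eqP->]].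
  apply: andb_id2l => /subset_leq_card le_ST.
  by rewrite -val_eqE /= inordK.
by rewrite hornerM horner_exp hornerN hornerC rmorphM /= rmorphXn rmorphN.
Qed.

Lemma homology_poly_at0 (T : {set 'I_k.+1}) : ord0 \notin T -> T != set0 ->
  (homology_poly T)`_0 = 0.
Proof.
move=> T_pos T_neq0; rewrite -horner_coef0 horner_sum.
transitivity (\sum_(S : {set 'I_k.+1} | S \subset T) (-1) ^+ (#|T| - #|S|) : int).
  apply: eq_bigr => S sST; rewrite hornerM chain_poly_at0; last first.
    by apply: ranks_rank_seq; apply: contra T_pos; apply: (subsetP sST).
  by rewrite mulr1 horner_exp hornerN hornerC.
(* Pairs each [S] avoiding a chosen [x] of [T] with [x |: S], which has the opposite sign. *)
have [x xT] := set0Pn _ T_neq0; rewrite (bigID (fun S : {set _} => x \in S)) /=.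
rewrite (reindex_onto (fun S => x |: S) (fun S => S :\ x)) /=; last first.
  by move=> S /andP[_ xS]; rewrite setD1K.
apply/eqP; rewrite addr_eq0 -sumrN; apply/eqP; apply: eq_big => S.
  rewrite setU11 andbT subUset sub1set xT /=; apply: andb_id2l => _.
  apply/eqP/idP => [<-|xS]; last by rewrite setU1K.
  by rewrite !inE eqxx.
case/andP=> sub /eqP eq_S.
have nxS : x \notin S by rewrite -eq_S !inE eqxx.
have := subset_leq_card (andP sub).1; rewrite cardsU1 nxS => lt_ST.
by rewrite -(subnSK lt_ST) exprS mulN1r opprK.
Qed.

Lemma size_homology_poly (T : {set 'I_k.+1}) : ord0 \notin T ->
  (size (homology_poly T) <= (\max_(i in T) i).+1)%N.
Proof.
move=> T_pos; apply: (leq_trans (size_sum _ _ _)); apply/bigmax_leqP => S sST.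
have S_pos : ord0 \notin S by apply: contra T_pos; apply: (subsetP sST).
rewrite size_Msign; apply: (leq_trans (size_chain_poly (ranks_rank_seq S_pos))).
rewrite ltnS; case def_t: (rank_seq S) => [|t ts] //=.
have /rank_seqP[i iS ->] : t \in rank_seq S by rewrite def_t mem_head.
by apply: leq_bigmax_cond; apply: (subsetP sST).
Qed.

End WordTraces.

(** * Integer combinations of tensor powers *)

Section SpechtTrace.
Variables (F : fieldType) (A : finType).
Hypothesis A_gt0 : (0 < #|A|)%N.
Local Notation n := #|[set: A]|.

Lemma polytabloid_ker :
  (polytabloid_mx F A :=: kermx (const_mx 1 : 'M[F]_(n, 1)))%MS.
Proof.
apply/eqmxP/andP; split.
  apply/sumsmx_subP=> i _; apply/sumsmx_subP=> j _; rewrite genmxE.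
  by apply/sub_kermxP; rewrite mulmxBl -!rowE !row_const subrr.
have n_gt0 : (0 < n)%N by rewrite cardsT.
pose i0 := Ordinal n_gt0; apply/row_subP=> r.
have: row r (kermx (const_mx 1 : 'M[F]_(n, 1))) *m const_mx 1 = 0 :> 'M_(1, 1).
  by rewrite -row_mul mulmx_ker row0.
move: (row r _) => u /matrixP/(_ 0 0); rewrite !mxE => sum_u.
have {}sum_u : \sum_j u 0 j = 0.
  by rewrite -[RHS]sum_u; apply: eq_bigr => j _; rewrite mxE mulr1.
(* As the coordinates sum to 0, subtracting one fixed basis vector from all basis vectors changes
   nothing. *)
have -> : u = \sum_j u 0 j *: (delta_mx 0 j - delta_mx 0 i0).
  rewrite (eq_bigr _ (fun j _ => scalerBr _ _ _)) sumrB -row_sum_delta.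
  by rewrite -scaler_suml sum_u scale0r subr0.
apply: summx_sub => j _; apply: scalemx_sub.
by apply: (sumsmx_sup i0) => //; apply: (sumsmx_sup j); rewrite ?genmxE.
Qed.

(** The Specht module is the kernel of the coordinate sum, which maps the letters onto the trivial
    module; hence fixed points minus 1. *)
Lemma specht_trace g :
  \tr (specht_n1_1 F A g) = (#|fixed_letters g|%:Z - 1)%:~R.
Proof.
pose f : 'M[F]_(n, 1) := const_mx 1.
have hom_f : {in [set: {perm A}], forall g, letters_repr F A g *m f = f *m trivial_repr F [set:
  {perm A}] g}.
  move=> h _; rewrite mulmx1; apply/matrixP=> i j; rewrite !mxE.
  rewrite -[RHS](permmod_row (acts_letters A) h i (fun=> 1 : F)).
  by apply: eq_bigr => l _; rewrite !mxE.
have modK : mxmodule (letters_repr F A) (kermx f).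
  by rewrite -(eqmx_module _ polytabloid_ker) polytabloid_module.
have imf : (<<f>> :=: 1%:M)%MS.
  apply/eqmxP; rewrite submx1 sub1mx /row_full eqn_leq rank_leq_col genmxE lt0n mxrank_eq0 /=.
  have n_gt0 : (0 < n)%N by rewrite cardsT.
  apply: contraTneq (oner_neq0 F) => /matrixP/(_ (Ordinal n_gt0) 0).
  by rewrite !mxE => ->; rewrite eqxx.
have modI : mxmodule (trivial_repr F [set: {perm A}]) <<f>>%MS.
  by rewrite (eqmx_module _ imf) mxmodule1.
have := mxtrace_ker_im modK modI hom_f (in_setT g).
rewrite mxtrace_permmod (mxtrace_submod1 _ imf) ?inE // mxtrace1.
rewrite (mxtrace_submod_eqmx modK (polytabloid_module F A)) ?inE //; last first.
  exact: eqmx_sym polytabloid_ker.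
move/esym/(canRL (addrK _)) => /= ->; rewrite rmorphB /= -pmulrn; congr (_%:R - _).
by apply: eq_card => a; rewrite !inE.
Qed.
End SpechtTrace.

Section CombinationTraces.
Variables (F : fieldType) (gT : finGroupType) (G : {group gT}).

Lemma mxtrace_tensor_power (V : representation F G) i x :
  \tr (tensor_power V i x) = \tr (V x) ^+ i.
Proof.
elim: i => [|i IHi]; first by rewrite /= mxtrace1.
by rewrite exprS -IHi; apply: mxtrace_prod.
Qed.

Lemma mxtrace_dadd (V W : representation F G) x :
  \tr (dadd_grepr V W x) = \tr (V x) + \tr (W x).
Proof. exact: mxtrace_block. Qed.

Lemma mxtrace_multiple_sum (W : nat -> representation F G) r c x :
  \tr (multiple_sum W r c x) = \sum_(i <- r) \tr (W i x) *+ c i.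
Proof.
have tr0 : \tr (grepr0 x : 'M[F]_(rdegree (@grepr0 F gT G))) = 0 by rewrite mxtrace1.
have morph := big_morph (fun V : representation F G => \tr (V x)) (fun V W =>
  mxtrace_dadd V W x) tr0.
rewrite /multiple_sum morph; apply: eq_bigr => i _.
by rewrite /muln_grepr morph sumr_const card_ord.
Qed.
End CombinationTraces.

Section Combinations.
Variables (F : numClosedFieldType) (gT : finGroupType) (G : {group gT}).
Variables (U V : representation F G) (x : gT -> int) (p : {poly int}).
Hypothesis trU : {in G, forall g, \tr (U g) = (x g)%:~R}.
Hypothesis trV : {in G, forall g, \tr (V g) = (p.[x g])%:~R}.

Lemma nat_combination_of_trace : (forall i, 0 <= p`_i) ->
  nat_combination V (tensor_power U) (iota 0 (size p)).
Proof.
move=> p_ge0; exists (fun i : nat => absz p`_i); apply: rsim_of_eq_mxtrace => g Gg.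
rewrite trV // mxtrace_multiple_sum horner_coef rmorph_sum /=.
rewrite -[X in iota 0 X]subn0 -/(index_iota 0 (size p)) big_mkord; apply: eq_bigr => i _;
  rewrite mxtrace_tensor_power trU //.
by rewrite rmorphM rmorphXn /= -mulr_natl pmulrn gez0_abs.
Qed.

Lemma int_combination_of_trace m : p`_0 = 0 -> (size p <= m.+1)%N ->
  int_combination V (tensor_power U) (iota 1 m).
Proof.
move=> p0 le_pm.
(* Positive and negative parts of the coefficients; the negative terms are moved to the side of
   [V]. *)
pose a (i : nat) := if p`_i is Posz n then n else 0%N.
pose b (i : nat) := if p`_i is Negz n then n.+1 else 0%N.
have def_p (i : nat) : p`_i = (a i)%:Z - (b i)%:Z.
  by rewrite /a /b; case: p`_i => j; rewrite ?subr0 // NegzE sub0r.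
exists a, b; apply: rsim_of_eq_mxtrace => g Gg.
rewrite mxtrace_dadd !mxtrace_multiple_sum trV //.
rewrite (horner_coef_wide _ le_pm) big_ord_recl p0 mul0r add0r rmorph_sum /=.
rewrite (_ : iota 1 m = index_iota 1 m.+1); last by rewrite /index_iota subn1.
rewrite !big_add1 !big_mkord -big_split; apply: eq_bigr => i _.
rewrite [in LHS]/= mxtrace_tensor_power trU // def_p rmorphM rmorphB rmorphXn /= -!pmulrn.
by rewrite mulrBl !mulr_natl subrK.
Qed.
End Combinations.

Local Close Scope ring_scope.

Theorem theorem21 (R : realType) (A : finType) (n k : nat)
    (cardA : #|A| = n) (n_ge2 : 2 <= n) (k_ge1 : 1 <= k) :
  let S_n1_1 := specht_n1_1 (complex R) A in
  (forall S : {set 'I_k.+1}, ord0 \notin S ->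
     exists N : nat,
       nat_combination (Representation (word_max_chain_repr (complex R) A S))
         (tensor_power S_n1_1) (iota 0 N)) /\
  (forall T : {set 'I_k.+1}, ord0 \notin T -> T != set0 ->
     int_combination
       (Representation (word_homology_repr (complex R) A T #|T|.-1))
       (tensor_power S_n1_1) (iota 1 (\max_(i in T) i))).
Proof.
have A_gt0 : (0 < #|A|)%N by rewrite cardA; apply: leq_trans n_ge2.
pose x (g : {perm A}) : int := (#|fixed_letters g|%:Z - 1)%R.
have trU : {in [set: {perm A}], forall g, (\tr (specht_n1_1 (complex R) A g) = (x g)%:~R)%R}.
  by move=> g _; apply: specht_trace.
split=> [S S_pos | T T_pos T_neq0].
  exists (size (chain_poly (rank_seq S))).
  apply: (nat_combination_of_trace trU) => [g _|i]; last exact: chain_poly_ge0.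
  exact: max_chain_trace.
apply: (int_combination_of_trace trU (p := homology_poly T)) => [g _||].
- exact: homology_trace.
- exact: homology_poly_at0.
exact: size_homology_poly.
Qed.
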